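(* Let $(\mathcal A,\mathcal H,D)$ be the spectral triple associated with a uniformly generated symmetric fractal $F$, where the similarities $w_{n,i}$, $i=1,\dots,p_n$, have scaling parameter $\lambda_n$. Then $$\underline{\delta}(\mathcal A,\mathcal H,D)=\liminf_{n,k\to\infty}\frac{\sum_{j=n}^{n+k}\log p_j}{\sum_{j=n}^{n+k}\log 1/\lambda_j},\qquad \overline{\delta}(\mathcal A,\mathcal H,D)=\limsup_{n,k\to\infty}\frac{\sum_{j=n}^{n+k}\log p_j}{\sum_{j=n}^{n+k}\log 1/\lambda_j}.$$
   Context: Symmetric fractal: let $a<b$, let $p_n\ge2$ be integers and $\lambda_n>0$ with $p_n\lambda_n<1$, $n\ge1$. For each $n$ let $w_{n,1},\dots,w_{n,p_n}$ be similarities of $\mathbb R$ with scaling parameter $\lambda_n$ mapping $[a,b]$ onto $p_n$ disjoint closed subintervals of $[a,b]$ of length $\lambda_n(b-a)$, equally spaced, the first having left endpoint $a$ and the last having right endpoint $b$ (consecutive ones separated by gaps of length $(b-a)\frac{1-p_n\lambda_n}{p_n-1}$). Put $w_n(\Omega)=\bigcup_iw_{n,i}(\Omega)$ and $F=\bigcap_nw_1\circ\cdots\circ w_n([a,b])$. $F$ is uniformly generated if $\sup_np_n<\infty$ and $\sup_np_n\lambda_n<1$. For a multi-index $\sigma$ of length $n$, $w_\sigma=w_{1,\sigma(1)}\circ\cdots\circ w_{n,\sigma(n)}$. Spectral triple: for a bounded interval $I$ let $\mathcal H(I)=\ell^2(\partial I)$, $D(I)=\frac1{|I|}\begin{pmatrix}0&1\\1&0\end{pmatrix}$.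 Let $I_1,I_2,\dots$ be the lacunae of $F$ (connected components of $[a,b]\setminus F$), $\mathcal H_\ell=\bigoplus_k\mathcal H(I_k)$, $D_\ell=\bigoplus_kD(I_k)$; let $\mathcal F_n=\{w_\sigma([a,b]):|\sigma|=n\}$ (with $\mathcal F_0=\{[a,b]\}$), $\mathcal H_f=\bigoplus_{n,\,I\in\mathcal F_n}\mathcal H(I)$, $D_f=\bigoplus_{n,\,I\in\mathcal F_n}D(I)$. Then $\mathcal H=\mathcal H_\ell\oplus\mathcal H_f$, $D=D_\ell\oplus D_f$, and $\mathcal A=\mathrm{Lip}(F)$ acts by pointwise multiplication. Minimal and maximal dimension: let $\mu(x)$ equal the $n$-th eigenvalue ($n\ge0$, non-increasing order, with multiplicity) of $|D|^{-1}$ for $x\in[n,n+1)$, and $f(t)=-\log\mu(e^t)$. Then (conventions $1/0=\infty$, $1/\infty=0$) $$\underline{\delta}(\mathcal A,\mathcal H,D)=\Big(\lim_{h\to\infty}\limsup_{t\to\infty}\tfrac{f(t+h)-f(t)}{h}\Big)^{-1},\qquad \overline{\delta}(\mathcal A,\mathcal H,D)=\Big(\lim_{h\to\infty}\liminf_{t\to\infty}\tfrac{f(t+h)-f(t)}{h}\Big)^{-1}.$$ For a double sequence, $\liminf_{n,k\to\infty}c_{n,k}=\lim_{N\to\infty}\inf_{n,k\ge N}c_{n,k}$, and similarly for $\limsup$. *)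

(* Defs.v *)
From HB Require Import structures.
From mathcomp Require Import all_boot all_order all_algebra.
From mathcomp Require Import complex.
From mathcomp Require Import all_classical all_reals all_analysis.
Import Order.TTheory GRing.Theory Num.Theory numFieldNormedType.Exports.

Set Implicit Arguments.
Unset Strict Implicit.
Unset Printing Implicit Defensive.

Local Open Scope classical_set_scope.
Local Open Scope ring_scope.
Local Open Scope complex_scope.

Section SymmetricFractal.
Context {R : realType}.
Variables (a b : R) (p : nat -> nat) (lambda : nat -> R).
(* [w n i] is the similarity w_{n,i}, used only for n >= 1 and 1 <= i <= p n. *)
Variable w : nat -> nat -> R -> R.

Definition similarity (r : R) (f : R -> R) : Prop :=
  forall x y, `|f x - f y| = r * `|x - y|.

Definition gap (n : nat) : R :=
  (b - a) * (1 - (p n)%:R * lambda n) / ((p n)%:R - 1).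

(* Left endpoint of the i-th of the p_n equally spaced subintervals; it is [a]
   for i = 1, and the right endpoint is [b] for i = p n. *)
Definition left_end (n i : nat) : R :=
  a + (i%:R - 1) * (lambda n * (b - a) + gap n).

Record symmetric_system : Prop := SymmetricSystem {
  sym_ab : a < b;
  sym_p : forall n, (1 <= n)%N -> (2 <= p n)%N;
  sym_lambda : forall n, (1 <= n)%N -> 0 < lambda n;
  sym_plambda : forall n, (1 <= n)%N -> (p n)%:R * lambda n < 1;
  sym_similarity : forall n i, (1 <= n)%N -> (1 <= i <= p n)%N ->
    similarity (lambda n) (w n i);
  sym_image : forall n i, (1 <= n)%N -> (1 <= i <= p n)%N ->
    w n i @` `[a, b]%classic = `[left_end n i, left_end n i + lambda n * (b - a)]%classic
}.

Definition uniformly_generated : Prop :=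
  (ereal_sup [set ((p n)%:R : R)%:E | n in [set n | (1 <= n)%N]] < +oo)%E /\
  (ereal_sup [set ((p n)%:R * lambda n)%:E | n in [set n | (1 <= n)%N]] < 1)%E.

Definition w_union (n : nat) (Omega : set R) : set R :=
  \bigcup_(i in [set i | (1 <= i <= p n)%N]) (w n i @` Omega).

(* w_1 o ... o w_n *)
Fixpoint w_iter (n : nat) (Omega : set R) : set R :=
  if n is m.+1 then w_iter m (w_union m.+1 Omega) else Omega.

Definition fractal : set R :=
  \bigcap_(n in [set n | (1 <= n)%N]) w_iter n `[a, b]%classic.

(* w_sigma = w_{1,sigma(1)} o ... o w_{n,sigma(n)}; only the values of sigma at
   1, ..., n matter. *)
Fixpoint w_word (n : nat) (sigma : nat -> nat) : R -> R :=
  if n is m.+1 then w_word m sigma \o w m.+1 (sigma m.+1) else id.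

Definition cells (n : nat) : set (set R) :=
  [set w_word n sigma @` `[a, b]%classic |
     sigma in [set sigma | forall j, (1 <= j <= n)%N -> (1 <= sigma j <= p j)%N]].

Definition lacunae : set (set R) :=
  [set connected_component (`[a, b]%classic `\` fractal) x |
     x in `[a, b]%classic `\` fractal].

End SymmetricFractal.

Section Operators.
Context {R : realType} {J : choiceType}.
Local Notation C := R[i].

Definition l2 : set (J -> C) :=
  [set xi | (\esum_(j in setT) ((complex.Re (xi j)) ^+ 2 + (complex.Im (xi j)) ^+ 2)%:E < +oo)%E].

(* Meaningful only for absolutely summable families. *)
Definition real_sum (u : J -> R) : R :=
  fine (\esum_(j in setT) ((EFin \o u)^\+%E j)) -
  fine (\esum_(j in setT) ((EFin \o u)^\-%E j)).

(* Linear in the first variable. *)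
Definition inner (xi eta : J -> C) : C :=
  Complex (real_sum (fun j => complex.Re (xi j * (eta j)^*)))
          (real_sum (fun j => complex.Im (xi j * (eta j)^*))).

(* A possibly unbounded operator on l2 is represented by its graph, so that
   [G (xi, chi)] reads "xi is in the domain and is mapped to chi". *)
Definition graph := set ((J -> C) * (J -> C)).

Record is_operator (G : graph) : Prop := IsOperator {
  op_l2 : forall xi chi, G (xi, chi) -> l2 xi /\ l2 chi;
  op_functional : forall xi chi chi', G (xi, chi) -> G (xi, chi') -> chi = chi';
  op_0 : G (cst 0, cst 0);
  op_lin : forall (c : C) xi chi xi' chi', G (xi, chi) -> G (xi', chi') ->
    G (fun j => c * xi j + xi' j, fun j => c * chi j + chi' j)
}.

Definition op_comp (G1 G2 : graph) : graph :=
  [set xc | exists2 eta, G2 (xc.1, eta) & G1 (eta, xc.2)].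

Definition op_inv (G : graph) : graph := [set xc | G (xc.2, xc.1)].

Definition op_adjoint (G : graph) : graph :=
  [set ez | [/\ l2 ez.1, l2 ez.2 &
     forall xi chi, G (xi, chi) -> inner chi ez.1 = inner xi ez.2]].

Definition op_positive (G : graph) : Prop :=
  forall xi chi, G (xi, chi) -> 0 <= inner chi xi.

(* |D| is the unique positive self-adjoint square root of D* D.  (Density of the
   domain follows from [op_adjoint A = A] when [A] is single-valued.) *)
Definition is_op_abs (D A : graph) : Prop :=
  [/\ is_operator A, op_adjoint A = A, op_positive A &
      op_comp A A = op_comp (op_adjoint D) D].

Definition op_abs (D : graph) : graph := get (is_op_abs D).

Definition lin_indep (m : nat) (e : 'I_m -> J -> C) : Prop :=
  forall c : 'I_m -> C,
    (forall j, \sum_(i < m) c i * e i j = 0) -> forall i, c i = 0.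

(* [mu] is non-increasing and each complex number alpha is listed by [mu] as many
   times as the dimension of the eigenspace ker (T - alpha). *)
Definition is_eigenvalue_sequence (T : graph) (mu : nat -> R) : Prop :=
  (forall m n, (m <= n)%N -> mu n <= mu m) /\
  forall (alpha : C) (m : nat),
    (exists2 e : 'I_m -> J -> C, lin_indep e &
       forall i, T (e i, fun j => alpha * e i j)) <->
    (exists2 s : 'I_m -> nat, injective s & forall i, (mu (s i))%:C = alpha).

Definition eigenvalue_sequence (T : graph) : nat -> R :=
  get (is_eigenvalue_sequence T).

End Operators.

Arguments graph : clear implicits.

(* The data (A, H, D), with H = l2(st_index) and A acting on H through
   [st_rep]. *)
Record spectral_triple (R : realType) := SpectralTriple {
  st_index : choiceType;
  st_alg : Type;
  st_rep : st_alg -> graph R st_index;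
  st_dirac : graph R st_index
}.

Arguments st_rep {R} _ _.
Arguments st_dirac {R} _.

Section Dimensions.
Context {R : realType}.
Variable X : spectral_triple R.

(* Equal to the n-th eigenvalue of |D|^{-1} on [n, n + 1), for n >= 0. *)
Definition st_mu (x : R) : R :=
  eigenvalue_sequence (op_inv (op_abs (st_dirac X))) (Num.truncn x).

Definition st_f (t : R) : R := - ln (st_mu (expR t)).

Definition increment_ratio (h t : R) : \bar R :=
  ((st_f (t + h) - st_f t) / h)%:E.

(* The inverse on \bar R satisfies 0^-1 = +oo and +oo^-1 = 0. *)
Definition lower_delta : \bar R :=
  ((lim (limf_esup (increment_ratio h) (pinfty_nbhs R) @[h --> +oo%R]))^-1)%E.

Definition upper_delta : \bar R :=
  ((lim (limf_einf (increment_ratio h) (pinfty_nbhs R) @[h --> +oo%R]))^-1)%E.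

End Dimensions.

Section FractalTriple.
Context {R : realType}.
Variables (a b : R) (p : nat -> nat) (w : nat -> nat -> R -> R).
Local Notation C := R[i].
Local Notation F := (fractal a b p w).

Definition Lip : Type :=
  {g : F -> C | exists L : R,
     forall x y : F, `|g x - g y| <= (L * `|val x - val y|)%:C}.

Definition cell_summands : set (nat * set R) := [set nI | cells a b p w nI.1 nI.2].

(* Index set of the direct sum: one summand for each lacuna, and one for each
   pair (n, I) with I in F_n. *)
Definition summand : choiceType :=
  (set_type (lacunae a b p w) + set_type cell_summands)%type.

Definition summand_interval (k : summand) : set R :=
  match k with inl U => val U | inr nU => (val nU).2 end.

(* Each interval I contributes l2 of its boundary {inf I, sup I}; the boundary is
   indexed by 'I_2, with 0 standing for inf I and 1 for sup I. *)
Definition bd_index : choiceType := (summand * 'I_2)%type.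

Definition bd_point (j : bd_index) : R :=
  if j.2 == 0 then inf (summand_interval j.1) else sup (summand_interval j.1).

Definition interval_length (I : set R) : R := sup I - inf I.

Definition interval_dirac (I : set R) : 'M[C]_2 :=
  ((interval_length I)^-1)%:C *: \matrix_(i < 2, j < 2) (i != j)%:R.

(* Direct sum of the matrices D(I), on its maximal domain. *)
Definition fractal_dirac : graph R bd_index :=
  [set xc | [/\ l2 xc.1, l2 xc.2 &
     forall k i, xc.2 (k, i) =
       \sum_(j < 2) interval_dirac (summand_interval k) i j * xc.1 (k, j)]].

(* Pointwise multiplication by a function on F; [insub x] is [Some] of the point
   of F underlying x, so the default value 0 is never used at boundary points. *)
Definition fractal_rep (g : Lip) : graph R bd_index :=
  [set xc | l2 xc.1 /\
     forall j, xc.2 j = oapp (sval g) 0 (insub (bd_point j)) * xc.1 j].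

Definition fractal_triple : spectral_triple R :=
  SpectralTriple fractal_rep fractal_dirac.

End FractalTriple.

Section DoubleLimits.
Context {R : realType}.

Definition dlim_inf (c : nat -> nat -> R) : \bar R :=
  lim ((fun N : nat => ereal_inf
    [set (c nk.1 nk.2)%:E | nk in [set nk | (N <= nk.1)%N /\ (N <= nk.2)%N]])
    @ \oo).

Definition dlim_sup (c : nat -> nat -> R) : \bar R :=
  lim ((fun N : nat => ereal_sup
    [set (c nk.1 nk.2)%:E | nk in [set nk | (N <= nk.1)%N /\ (N <= nk.2)%N]])
    @ \oo).

Definition log_ratio (p : nat -> nat) (lambda : nat -> R) (n k : nat) : R :=
  (\sum_(n <= j < (n + k).+1) ln ((p j)%:R : R)) /
  (\sum_(n <= j < (n + k).+1) ln (1 / lambda j)).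

End DoubleLimits.

(* Main.v *)
(* Every interval I contributes a two-dimensional summand on which |D| = 1/|I|,
   so the eigenvalues of |D|^-1 are the lengths of the lacunae and of the cells,
   each counted twice.  Let P_n = p_1...p_n and Lambda_n = lambda_1...lambda_n.
   There are P_n cells of level n, of length Lambda_n (b - a).  A lacuna longer
   than that has its left endpoint in a cell of level n, and no two such lacunae
   share a cell; with 2 <= p_j this leaves at most 4 P_n <= P_(n+2) eigenvalues
   above Lambda_n (b - a).  Hence, up to a bounded shift of the index, f(ln P_n)
   is -ln Lambda_n plus a constant.

   Since ln p_j is bounded, a window of length h in t corresponds to a block of
   indices whose ln p_j sum to h + O(1), so bounds on the ratios give bounds on
   the increments of f.  Conversely, f(t + h) - f(t) <= v h for large t iterates
   to f(t + j h) - f(t) <= v j h, which bounds the ratio over long blocks below by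
   1/v up to a vanishing error; the opposite inequality is symmetric. *)
Require Import Defs.
From mathcomp Require Import all_boot all_order all_algebra complex.
From mathcomp Require Import all_classical all_reals all_analysis.
From mathcomp Require Import ring lra zify.
Import Order.TTheory GRing.Theory Num.Theory numFieldNormedType.Exports.

Set Implicit Arguments.
Unset Strict Implicit.
Unset Printing Implicit Defensive.

Local Open Scope classical_set_scope.
Local Open Scope ring_scope.
Local Open Scope complex_scope.

(** * Geometry of the fractal *)

Section Gaps.
Context {R : realType}.
Variables (a b : R) (F : set R).
Hypotheses (F_closed : closed F) (Fa : F a) (Fb : F b).

Local Notation E := (`[a, b]%classic `\` F).
Local Notation gaps := [set connected_component E x | x in E].

Lemma gap_nbhs x : E x -> exists2 e : R, 0 < e & forall y, `|x - y| < e -> E y.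
Proof.
have -> : E = `]a, b[%classic `\` F.
  apply/seteqP; split=> y [] /=; rewrite !in_itv /= => /andP[ay yb] Fy; split => //.
    rewrite ?in_itv /= !lt_neqAle ay yb !andbT; apply/andP.
    by split; apply: contra_notN Fy => /eqP; [move=> <- | move=> ->].
  by rewrite ?in_itv /= !ltW.
have Eopen : open (`]a, b[%classic `\` F).
  by apply: openI; [exact: itv_open | exact: closed_openC].
move=> Ex; have /nbhs_ballP[e e0 eE] := open_nbhs_nbhs (conj Eopen Ex).
by exists e => // y xy; exact: eE.
Qed.

Lemma gap_component_ball x (e : R) : 0 < e -> (forall y, `|x - y| < e -> E y) ->
  forall y, `|x - y| < e -> connected_component E x y.
Proof.
move=> e0 eE y xy.
apply: (@connected_component_max _ E [set z | `|x - z| < e] x) => //=.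
  by rewrite subrr normr0.
apply/connected_intervalP => u v /= ux vx z /andP[uz zv].
move: ux vx; rewrite !ltr_norml => /andP[? ?] /andP[? ?]; apply/andP; split; lra.
Qed.

Lemma gap_sub U : gaps U -> forall x, U x -> a <= x <= b.
Proof. by move=> [x _ <-] y /connected_component_sub[]; rewrite /= in_itv. Qed.

Lemma gap_bounded U : gaps U -> has_lbound U /\ has_ubound U.
Proof.
by move=> /gap_sub H; split; [exists a | exists b] => x /H/andP[].
Qed.

Lemma gap_neq0 U : gaps U -> U !=set0.
Proof. by move=> [x Ex <-]; exists x; exact: connected_component_refl. Qed.

Lemma gap_length_gt0 U : gaps U -> 0 < interval_length U.
Proof.
move=> gU; have [lU uU] := gap_bounded gU; case: gU lU uU => x Ex <- lU uU.
have [e e0 eE] := gap_nbhs Ex; have ball := gap_component_ball e0 eE.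
rewrite /interval_length subr_gt0; apply: (@lt_le_trans _ _ (x + e / 2)).
  apply: (@le_lt_trans _ _ x); last lra.
  by apply: ge_inf => //; exact: connected_component_refl.
apply: ub_le_sup => //; apply: ball.
by rewrite opprD addrA subrr add0r normrN gtr0_norm; lra.
Qed.

Lemma gap_inf U : gaps U -> F (inf U).
Proof.
move=> gU; have [lU uU] := gap_bounded gU; have subU := gap_sub gU.
have U0 := gap_neq0 gU; case: gU => x Ex UE; apply: contrapT => nF.
have Ec : E (inf U).
  split => //=; rewrite in_itv /=; apply/andP; split.
    by apply: lb_le_inf => // y /subU/andP[].
  by case: U0 => y Uy; have /andP[_] := subU _ Uy; apply: le_trans; exact: ge_inf.
have [e e0 eE] := gap_nbhs Ec; have ball := gap_component_ball e0 eE.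
have [y Uy yc] : exists2 y, U y & y < inf U + e by apply: inf_lt => //; lra.
have cy := ge_inf lU Uy.
have xc : connected_component E x (inf U - e / 2).
  apply: (@connected_component_trans _ _ y); first by rewrite UE.
  apply: (@connected_component_trans _ _ (inf U)).
    by apply: connected_component_sym; apply: ball; rewrite ltr_norml; lra.
  by apply: ball; rewrite ltr_norml; lra.
rewrite UE in xc; have := ge_inf lU xc; lra.
Qed.

Lemma gap_disjoint U V x : gaps U -> gaps V -> U x -> V x -> U = V.
Proof.
move=> [u _ <-] [v _ <-] /same_connected_component -> /same_connected_component ->.
by [].
Qed.

Lemma gap_order U V : gaps U -> gaps V -> U <> V ->
  sup U <= inf V \/ sup V <= inf U.
Proof.
wlog: U V / exists2 u, U u & exists2 v, V v & u <= v.
  move=> wl gU gV UV; have [u Uu] := gap_neq0 gU; have [v Vv] := gap_neq0 gV.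
  have [uv|/ltW vu] := leP u v; first by apply: wl => //; exists u => //; exists v.
  by apply/or_comm; apply: wl => //; [exists v => //; exists u|exact/nesym].
move=> [u Uu [v Vv uv]] gU gV UV; left.
have interval W : gaps W -> is_interval W.
  by move=> [x _ <-]; apply/connected_intervalP; exact: component_connected.
apply: ge_sup; first exact: gap_neq0.
move=> s Us; apply: lb_le_inf; first exact: gap_neq0.
move=> t Vt; rewrite leNgt; apply/negP => ts; apply: UV.
have [tu|ut] := leP t u.
  by apply: (@gap_disjoint _ _ u) => //; apply: (interval _ gV _ _ Vt Vv); rewrite tu.
by apply: (@gap_disjoint _ _ t) => //; apply: (interval _ gU _ _ Uu Us); rewrite !ltW.
Qed.

End Gaps.

Section Similarities.
Context {R : realType}.
Implicit Types (f : R -> R) (r : R).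

Lemma similarity_affine r f : similarity r f ->
  exists2 v, v ^+ 2 = r ^+ 2 & forall x, f x = f 0 + v * x.
Proof.
move=> Hf; have sq x y : (f x - f y) ^+ 2 = r ^+ 2 * (x - y) ^+ 2.
  by rewrite -[LHS]real_normK ?num_real // Hf exprMn real_normK ?num_real.
exists (f 1 - f 0); first by rewrite sq subr0 expr1n mulr1.
move=> x; have h1 := sq x 0; have h2 := sq x 1; have h3 := sq 1 0.
have [r0|r0] := eqVneq (r ^+ 2) 0.
  move: h1 h3; rewrite r0 !mul0r => /eqP; rewrite sqrf_eq0 => /eqP ? /eqP.
  rewrite sqrf_eq0 => /eqP ->; lra.
apply/eqP; rewrite -subr_eq0 -(mulrI_eq0 _ (mulfI r0)); apply/eqP.
have -> : r ^+ 2 = (f 1 - f 0) ^+ 2 by rewrite h3; ring.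
have h4 : (f x - f 0) * (f 1 - f 0) = r ^+ 2 * x.
  move: h1 h2 h3; rewrite !expr2; lra.
have h5 : (f 1 - f 0) ^+ 2 = r ^+ 2 by rewrite h3; ring.
have -> : (f 1 - f 0) ^+ 2 * (f x - (f 0 + (f 1 - f 0) * x)) =
   (f 1 - f 0) * ((f x - f 0) * (f 1 - f 0) - (f 1 - f 0) ^+ 2 * x) by ring.
by rewrite h4 h5 subrr mulr0.
Qed.

Lemma similarity_inj r f : 0 < r -> similarity r f -> injective f.
Proof.
move=> r0 Hf x y fxy; have /esym/eqP := Hf x y.
by rewrite fxy subrr normr0 mulf_eq0 gt_eqF //= normr_eq0 subr_eq0 => /eqP.
Qed.

Lemma similarity_comp r s f g : similarity r f -> similarity s g ->
  similarity (r * s) (f \o g).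
Proof. by move=> Hf Hg x y; rewrite /= Hf Hg mulrA. Qed.

Lemma similarity_slope r f : 0 < r -> similarity r f ->
  (forall x, f x = f 0 + r * x) \/ (forall x, f x = f 0 - r * x).
Proof.
move=> r0 /similarity_affine[v /eqP]; rewrite eqf_sqr => /orP[/eqP->|/eqP->] H.
  by left.
by right => x; rewrite {1}H mulNr.
Qed.

Lemma similarity_image r f c d : 0 < r -> similarity r f -> c <= d ->
  exists z, f @` `[c, d]%classic = `[z, z + r * (d - c)]%classic.
Proof.
move=> r0 Hf cd; have [fE|fE] := similarity_slope r0 Hf.
  exists (f c); apply/seteqP; split=> y /=.
    move=> [x]; rewrite /= !in_itv /= => /andP[cx xd] <-.
    rewrite (fE x) (fE c); have := ler_wpM2l (ltW r0) cx.
    by have := ler_wpM2l (ltW r0) xd; lra.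
  rewrite in_itv /= (fE c) => /andP[h1 h2]; exists ((y - f 0) / r).
    by rewrite /= in_itv /= ler_pdivlMr // ler_pdivrMr //; lra.
  by rewrite fE mulrCA divff ?gt_eqF // mulr1; ring.
exists (f d); apply/seteqP; split=> y /=.
  move=> [x]; rewrite /= !in_itv /= => /andP[cx xd] <-.
  rewrite (fE x) (fE d); have := ler_wpM2l (ltW r0) cx.
  by have := ler_wpM2l (ltW r0) xd; lra.
rewrite in_itv /= (fE d) => /andP[h1 h2]; exists ((f 0 - y) / r).
  by rewrite /= in_itv /= ler_pdivlMr // ler_pdivrMr //; lra.
by rewrite fE mulrCA divff ?gt_eqF // mulr1; ring.
Qed.

Lemma similarity_closed r f (A : set R) : 0 < r -> similarity r f -> closed A ->
  closed (f @` A).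
Proof.
move=> r0 Hf Acl; have [v v2 fE] := similarity_affine Hf.
have v0 : v != 0 by rewrite -sqrf_eq0 v2 sqrf_eq0 gt_eqF.
have -> : f @` A = (fun y => (y - f 0) / v) @^-1` A.
  apply/seteqP; split=> [_ [x Ax <-]|y Ay] /=.
    by rewrite fE addrAC subrr add0r mulrAC divff // mul1r.
  by exists ((y - f 0) / v) => //; rewrite fE mulrCA divff // mulr1; ring.
apply: preimage_closed => // y _.
by apply: cvgM; [apply: cvgB; [exact: cvg_id|exact: cvg_cst] | exact: cvg_cst].
Qed.

Lemma similarity_endpoints r f a b z : 0 < r -> a < b -> similarity r f ->
  f @` `[a, b]%classic = `[z, z + r * (b - a)]%classic ->
  [set z; z + r * (b - a)] `<=` f @` [set a; b].
Proof.
move=> r0 ab Hf fab.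
have zin : (f @` `[a, b]%classic) z.
  by rewrite fab /= in_itv /= lexx lerDl mulr_ge0 ?(ltW r0) // subr_ge0 ltW.
have zin' : (f @` `[a, b]%classic) (z + r * (b - a)).
  by rewrite fab /= in_itv /= lexx lerDl mulr_ge0 ?(ltW r0) // subr_ge0 ltW.
case: zin => x /=; rewrite in_itv /= => /andP[ax xb] fx.
case: zin' => y /=; rewrite in_itv /= => /andP[ay yb] fy.
have xy : `|x - y| = b - a.
  apply: (mulfI (lt0r_neq0 r0)); rewrite -Hf fx fy opprD addrA subrr sub0r normrN.
  by rewrite gtr0_norm // mulr_gt0 // subr_gt0.
have ends : x = a /\ y = b \/ x = b /\ y = a.
  have [xley|yltx] := leP x y; [left | right].
    by move: xy; rewrite ler0_norm ?subr_le0 // => xy; split; lra.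
  by move: xy; rewrite gtr0_norm ?subr_gt0 // => xy; split; lra.
move=> _ [] ->; [exists x => // | exists y => //].
  by case: ends => -[xE yE]; rewrite xE; [left | right].
by case: ends => -[xE yE]; rewrite yE; [right | left].
Qed.

End Similarities.

Section SymmetricSystem.
Context {R : realType}.
Variables (a b : R) (p : nat -> nat) (lambda : nat -> R) (w : nat -> nat -> R -> R).
Hypothesis hF : symmetric_system a b p lambda w.

Definition cell_count n : nat := \prod_(1 <= j < n.+1) p j.
Definition cell_scale n : R := \prod_(1 <= j < n.+1) lambda j.

Lemma cell_countS n : cell_count n.+1 = (cell_count n * p n.+1)%N.
Proof. by rewrite /cell_count big_nat_recr. Qed.

Lemma cell_scaleS n : cell_scale n.+1 = cell_scale n * lambda n.+1.
Proof. by rewrite /cell_scale big_nat_recr. Qed.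

Lemma cell_scale_gt0 n : 0 < cell_scale n.
Proof.
elim: n => [|n IH]; first by rewrite /cell_scale big_geq.
by rewrite cell_scaleS mulr_gt0 // (sym_lambda hF).
Qed.

Lemma lambda_lt_half n : (1 <= n)%N -> lambda n < 2^-1.
Proof.
move=> n1; have := sym_plambda hF n1; have l0 := sym_lambda hF n1.
have : 2 * lambda n <= (p n)%:R * lambda n by rewrite ler_pM2r // ler_nat (sym_p hF).
lra.
Qed.

Lemma cell_scale_le n : cell_scale n <= 2^-1 ^+ n.
Proof.
elim: n => [|n IH]; first by rewrite /cell_scale big_geq ?expr0.
rewrite cell_scaleS exprSr; apply: ler_pM => //; apply: ltW.
- exact: cell_scale_gt0.
- by apply: (sym_lambda hF).
- exact: lambda_lt_half.
Qed.

Lemma cell_scale_ltS n : cell_scale n.+1 < cell_scale n.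
Proof.
rewrite cell_scaleS gtr_pMr ?cell_scale_gt0 //.
by apply: lt_trans (lambda_lt_half _) _ => //; lra.
Qed.

Lemma cell_scale_anti m n : (m <= n)%N -> cell_scale n <= cell_scale m.
Proof.
move=> /subnK <-; elim: (n - m)%N => [|k IH]; first by rewrite add0n.
by rewrite addSn (le_trans (ltW (cell_scale_ltS _))).
Qed.

Lemma cell_count_gt0 n : (0 < cell_count n)%N.
Proof.
elim: n => [|n IH]; first by rewrite /cell_count big_geq.
by rewrite cell_countS muln_gt0 IH (leq_trans _ (sym_p hF _)).
Qed.

Lemma cell_count_double n : (2 * cell_count n <= cell_count n.+1)%N.
Proof. by rewrite cell_countS mulnC leq_mul2l (sym_p hF) // orbT. Qed.

Lemma cell_count_sum n : (\sum_(0 <= m < n) cell_count m <= cell_count n)%N.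
Proof.
elim: n => [|n IH]; first by rewrite big_geq.
rewrite big_nat_recr //= (leq_trans _ (cell_count_double n)) // mul2n -addnn.
by rewrite leq_add2r.
Qed.

Lemma cell_count_gt n : (n < cell_count n)%N.
Proof.
elim: n => [|n IH]; first exact: cell_count_gt0.
by apply: leq_trans (cell_count_double n); move: IH; lia.
Qed.

Let ab : a < b := sym_ab hF.
Let stride n := lambda n * (b - a) + gap a b p lambda n.

Let stride_gt n : (1 <= n)%N -> lambda n * (b - a) < stride n.
Proof.
move=> n1; rewrite /stride ltrDl /gap.
have pl := sym_plambda hF n1; have p1 : 1 < (p n)%:R :> R by rewrite ltr1n (sym_p hF).
by rewrite divr_gt0 ?mulr_gt0 ?subr_gt0.
Qed.

Let stride_total n : (1 <= n)%N ->
  ((p n)%:R - 1) * stride n + lambda n * (b - a) = b - a.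
Proof.
move=> n1; have p1 : (p n)%:R - 1 != 0 :> R.
  by rewrite subr_eq0 pnatr_eq1 gtn_eqF // (sym_p hF).
rewrite /stride /gap; field.
by [].
Qed.

Let cell_len_gt0 n : (1 <= n)%N -> 0 < lambda n * (b - a).
Proof. by move=> n1; rewrite mulr_gt0 ?(sym_lambda hF) // subr_gt0. Qed.

Lemma w_image_sub n i x : (1 <= n)%N -> (1 <= i <= p n)%N ->
  `[a, b]%classic x -> `[a, b]%classic (w n i x).
Proof.
move=> n1 ip x_ab; have : (w n i @` `[a, b]%classic) (w n i x) by exists x.
rewrite (sym_image hF n1 ip) /= !in_itv /= /left_end => /andP[h1 h2].
have len0 := cell_len_gt0 n1; have str := stride_gt n1; have tot := stride_total n1.
have /andP[i1 ipn] := ip.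
have ip1 : 0 <= (i%:R - 1 : R) by rewrite subr_ge0 ler1n.
have ipp : (i%:R : R) <= (p n)%:R by rewrite ler_nat.
have s0 : 0 < stride n by rewrite (lt_trans _ str).
have lo : 0 <= (i%:R - 1) * stride n by rewrite mulr_ge0 // ltW.
have hi : (i%:R - 1) * stride n <= ((p n)%:R - 1) * stride n.
  by rewrite ler_pM2r // lerD2r.
by move: h1 h2; rewrite -/(stride n); lra.
Qed.

Lemma w_image_disjoint n i j x y : (1 <= n)%N -> (1 <= i <= p n)%N ->
  (1 <= j <= p n)%N -> `[a, b]%classic x -> `[a, b]%classic y ->
  w n i x = w n j y -> i = j.
Proof.
move=> n1 ip jp xab yab.
wlog ij : i j x y ip jp xab yab / (i < j)%N.
  move=> wl wij; case: (ltngtP i j) => // [ij|ji].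
    exact: wl ip jp xab yab ij wij.
  exact: esym (wl _ _ _ _ jp ip yab xab ji (esym wij)).
have : (w n i @` `[a, b]%classic) (w n i x) by exists x.
have : (w n j @` `[a, b]%classic) (w n j y) by exists y.
rewrite (sym_image hF n1 ip) (sym_image hF n1 jp) /= !in_itv /= /left_end.
rewrite -/(stride n) => /andP[h1 _] /andP[_ h2] wij; exfalso.
have str := stride_gt n1; have len0 := cell_len_gt0 n1.
have : stride n * 1 <= stride n * (j%:R - i%:R).
  rewrite ler_pM2l ?(lt_trans len0) // lerBrDl -[1]/(1%:R) -natrD ler_nat.
  by rewrite addn1.
move: h1 h2; rewrite wij; lra.
Qed.

Definition valid_word n (s : nat -> nat) := forall j, (1 <= j <= n)%N -> (1 <= s j <= p j)%N.

Lemma valid_word_last n s : valid_word n.+1 s -> (1 <= s n.+1 <= p n.+1)%N.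
Proof. by apply; rewrite /= leqnn. Qed.

Lemma valid_wordW n s : valid_word n.+1 s -> valid_word n s.
Proof. by move=> H j /andP[j1 jn]; apply: H; rewrite j1 leqW. Qed.

Lemma w_word_similarity n s : valid_word n s -> similarity (cell_scale n) (w_word w n s).
Proof.
elim: n => [_ x y|n IH Hs]; first by rewrite /cell_scale big_geq // mul1r.
rewrite cell_scaleS; apply: similarity_comp; first exact: IH (valid_wordW Hs).
exact (sym_similarity hF (ltn0Sn _) (valid_word_last Hs)).
Qed.

Lemma w_word_ext n s t : (forall j, (1 <= j <= n)%N -> s j = t j) ->
  w_word w n s = w_word w n t.
Proof.
elim: n => //= n IH H; rewrite (H n.+1) ?leqnn // IH // => j /andP[j1 jn].
by apply: H; rewrite j1 leqW.
Qed.

Lemma w_word_disjoint n s t x y : valid_word n s -> valid_word n t ->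
  `[a, b]%classic x -> `[a, b]%classic y -> w_word w n s x = w_word w n t y ->
  forall j, (1 <= j <= n)%N -> s j = t j.
Proof.
elim: n x y => [|n IH] x y Hs Ht xab yab wE j; first by case: j.
have agree := IH _ _ (valid_wordW Hs) (valid_wordW Ht)
  (w_image_sub (ltn0Sn _) (valid_word_last Hs) xab) (w_image_sub (ltn0Sn _) (valid_word_last Ht) yab) wE.
move=> /andP[j1]; rewrite leq_eqVlt => /predU1P[->|jn]; last by rewrite agree // j1.
move: wE => /=; rewrite (w_word_ext agree).
move=> /(similarity_inj (cell_scale_gt0 n) (w_word_similarity (valid_wordW Ht))).
by apply: w_image_disjoint => //; exact: valid_word_last.
Qed.

Fixpoint words n : seq (seq nat) :=
  if n is m.+1 then [seq rcons u i | u <- words m, i <- iota 1 (p m.+1)] else [:: [::]].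

Lemma words_size n : size (words n) = cell_count n.
Proof.
elim: n => [|n IH]; first by rewrite /cell_count big_geq.
by rewrite cell_countS -IH /= size_allpairs size_iota.
Qed.

Lemma words_uniq n : uniq (words n).
Proof.
elim: n => //= n IH; apply: allpairs_uniq => //; first exact: iota_uniq.
by move=> [u i] [v j] _ _ /rcons_inj[-> ->].
Qed.

Definition word_fun (u : seq nat) (j : nat) := nth 0%N u j.-1.

Lemma words_length n u : u \in words n -> size u = n.
Proof.
elim: n u => [u|n IH u]; first by rewrite inE => /eqP ->.
by move=> /allpairsP[[v i] [/= /IH + _ ->]]; rewrite size_rcons => ->.
Qed.

Lemma words_valid n u : u \in words n -> valid_word n (word_fun u).
Proof.
elim: n u => [u _ j /andP[j1 /(leq_trans j1)]|n IH u] //.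
move=> /allpairsP[[v i] [/= vn + ->]] [|j] // /andP[_ jn]; have sv := words_length vn.
rewrite mem_iota /word_fun nth_rcons sv /= => ip; move: jn; rewrite ltnS leq_eqVlt.
move=> /predU1P[->|jn]; first by rewrite ltnn eqxx; move: ip; lia.
by rewrite jn; exact: (IH _ vn j.+1).
Qed.

Lemma words_complete n s : valid_word n s -> [seq s j | j <- iota 1 n] \in words n.
Proof.
elim: n => [|n IH Hs]; first by rewrite inE.
have -> : iota 1 n.+1 = rcons (iota 1 n) n.+1.
  by rewrite -(addn1 n) iotaD /= cats1 add1n addn1.
rewrite map_rcons; apply: allpairs_f.
  exact: IH (valid_wordW Hs).
by rewrite mem_iota; have := valid_word_last Hs; lia.
Qed.

Definition cell n (u : seq nat) : set R := w_word w n (word_fun u) @` `[a, b]%classic.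

Lemma cell_mem n u : u \in words n -> cells a b p w n (cell n u).
Proof. by move=> /words_valid Hu; exists (word_fun u). Qed.

Lemma cells_cell n s : valid_word n s ->
  exists2 u, u \in words n & w_word w n s @` `[a, b]%classic = cell n u.
Proof.
move=> Hs; exists [seq s j | j <- iota 1 n]; first exact: words_complete.
congr (_ @` _); apply: w_word_ext => j /andP[j1 jn].
rewrite /word_fun (nth_map 0%N) ?size_iota ?prednK //.
by rewrite nth_iota ?prednK // add1n prednK.
Qed.

Lemma cell_inj n : {in words n &, injective (cell n)}.
Proof.
move=> u v un vn uv.
have aab : `[a, b]%classic a by rewrite /= in_itv /= lexx ltW.
have [y yab yE] : cell n v (w_word w n (word_fun u) a) by rewrite -uv; exists a.
have agree := w_word_disjoint (words_valid un) (words_valid vn) aab yab (esym yE).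
apply: (@eq_from_nth _ 0%N); first by rewrite !(words_length un, words_length vn).
by rewrite (words_length un) => i ilt; exact: (agree i.+1).
Qed.

Lemma cell_itv n u : u \in words n ->
  exists z, cell n u = `[z, z + cell_scale n * (b - a)]%classic.
Proof.
move=> /words_valid/w_word_similarity Hs.
exact: similarity_image (cell_scale_gt0 n) Hs (ltW ab).
Qed.

Lemma cells_length n (I : set R) : cells a b p w n I ->
  interval_length I = cell_scale n * (b - a).
Proof.
move=> [s Hs <-]; have [u un ->] := cells_cell Hs; have [z ->] := cell_itv un.
have le : z <= z + cell_scale n * (b - a).
  by rewrite lerDl mulr_ge0 ?(ltW (cell_scale_gt0 n)) // subr_ge0 ltW.
by rewrite /interval_length inf_itvcc // sup_itvcc //; ring.
Qed.

Lemma w_iter_word n (X : set R) x : w_iter p w n X x ->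
  exists2 s, valid_word n s & (w_word w n s @` X) x.
Proof.
elim: n X => [X Ox|n IH X].
  exists (fun _ => 0%N); last by exists x.
  by move=> j /andP[j1 /(leq_trans j1)].
move=> /= /IH[s Hs [y [i ip [z Oz zy]] yx]].
pose t j := if j == n.+1 then i else s j.
have ts j : (1 <= j <= n)%N -> t j = s j.
  by move=> /andP[_ jn]; rewrite /t ltn_eqF.
exists t; last first.
  by exists z => //=; rewrite (w_word_ext ts) /t eqxx zy.
move=> j /andP[j1]; rewrite leq_eqVlt => /predU1P[->|jn].
  by rewrite /t eqxx.
by rewrite ts ?j1 //; apply: Hs; rewrite j1.
Qed.

Lemma fractal_cell n x : fractal a b p w x -> exists2 u, u \in words n & cell n u x.
Proof.
move=> Fx; have [->|n0] := posnP n.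
  have := Fx 1%N isT => /w_iter_word[s Hs [y yab <-]].
  exists [::]; first by rewrite inE.
  by exists (w_word w 1 s y) => //; apply: w_image_sub => //; exact: valid_word_last Hs.
have /w_iter_word[s Hs Hx] := Fx n n0.
by have [u un sE] := cells_cell Hs; exists u => //; rewrite -sE.
Qed.

Lemma w_iter_closed n (X : set R) : closed X -> closed (w_iter p w n X).
Proof.
elim: n X => //= n IH X Ocl; apply: IH; apply: closed_bigcup.
  apply: (@sub_finite_set _ _ `I_(p n.+1).+1); last exact: finite_II.
  by move=> i /= /andP[].
move=> i /= ip; apply: (similarity_closed (sym_lambda hF (ltn0Sn _)) (sym_similarity hF (ltn0Sn _) ip)).
exact: Ocl.
Qed.

Lemma fractal_closed : closed (fractal a b p w).
Proof. by apply: closed_bigI => n _; apply: w_iter_closed; exact: itv_closed. Qed.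

Lemma w_union_endpoints n : (1 <= n)%N -> forall X : set R,
  [set a; b] `<=` X -> [set a; b] `<=` w_union p w n X.
Proof.
move=> n1 X sub; have p2 := sym_p hF n1; have l0 := sym_lambda hF n1.
have ends i : (1 <= i <= p n)%N -> [set left_end a b p lambda n i;
    left_end a b p lambda n i + lambda n * (b - a)] `<=` w_union p w n X.
  move=> ip; have sim := sym_similarity hF n1 ip.
  apply: subset_trans (similarity_endpoints l0 ab sim (sym_image hF n1 ip)) _.
  by move=> _ [x xab <-]; exists i => //; exists x => //; exact: sub.
move=> _ [] ->.
  apply: (ends 1%N); first by rewrite /= (leq_trans _ p2).
  by left; rewrite /left_end subrr mul0r addr0.
apply: (ends (p n)); first by rewrite leqnn (leq_trans _ p2).
by right; rewrite /left_end -addrA stride_total // addrC subrK.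
Qed.

Lemma fractal_endpoints : [set a; b] `<=` fractal a b p w.
Proof.
suff H n : forall X : set R, [set a; b] `<=` X -> [set a; b] `<=` w_iter p w n X.
  move=> x xab n _; apply: H xab => _ [] ->; rewrite /= in_itv /= lexx ?andbT //; exact: ltW.
by elim: n => //= n IH X sub; apply: IH; exact: w_union_endpoints.
Qed.

End SymmetricSystem.

Lemma size_le_inj_in (S T : eqType) (f : S -> T) (s : seq S) (t : seq T) :
  uniq s -> {in s &, injective f} -> (forall x, x \in s -> f x \in t) ->
  (size s <= size t)%N.
Proof.
move=> us fi st; rewrite -(size_map f); apply: uniq_leq_size.
  by rewrite map_inj_in_uniq.
by move=> _ /mapP[x /st xt ->].
Qed.

Section SummandCounting.
Context {R : realType}.
Variables (a b : R) (p : nat -> nat) (lambda : nat -> R) (w : nat -> nat -> R -> R).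
Hypothesis hF : symmetric_system a b p lambda w.

Local Notation J := (bd_index a b p w).
Local Notation len := (fun j : J => interval_length (summand_interval j.1)).
Let F_closed := fractal_closed hF.
Let Fa : fractal a b p w a := fractal_endpoints hF (or_introl erefl).
Let Fb : fractal a b p w b := fractal_endpoints hF (or_intror erefl).

Let ab : 0 < b - a. Proof. by rewrite subr_gt0 (sym_ab hF). Qed.

Lemma lacuna_val (U : set_type (lacunae a b p w)) : lacunae a b p w (val U).
Proof. exact: set_mem (valP U). Qed.

Lemma cell_val (nI : set_type (cell_summands a b p w)) :
  cells a b p w (val nI).1 (val nI).2.
Proof. exact: set_mem (valP nI). Qed.

Lemma summand_length_gt0 (k : summand a b p w) :
  0 < interval_length (summand_interval k).
Proof.
case: k => [U|nI] /=; first exact (gap_length_gt0 F_closed Fa Fb (lacuna_val U)).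
by rewrite (cells_length hF (cell_val nI)) mulr_gt0 // (cell_scale_gt0 hF).
Qed.

Lemma lacunae_count n (l : seq (set_type (lacunae a b p w))) : uniq l ->
  (forall U, U \in l -> cell_scale lambda n * (b - a) < interval_length (val U)) ->
  (size l <= cell_count p n)%N.
Proof.
move=> ul long.
have ex (U : set_type (lacunae a b p w)) : exists u, u \in words p n /\ cell a b w n u (inf (val U)).
  have FU := gap_inf F_closed Fa Fb (lacuna_val U).
  by have [u un Uu] := fractal_cell hF n FU; exists u.
have [f fP] := choice ex.
rewrite -words_size; apply: (size_le_inj_in (f := f) ul) => [U V Ul Vl fUV|U _]; last first.
  by have [] := fP U.
apply: contrapT => UV.
have far (U1 U2 : set_type (lacunae a b p w)) : U1 \in l -> f U1 = f U2 ->
    sup (val U1) <= inf (val U2) -> False.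
  move=> U1l f12 s12; have := long _ U1l; have [un i1] := fP U1; have [_ i2] := fP U2.
  move: i1 i2; rewrite -f12; have [z ->] := cell_itv hF un.
  rewrite /= !in_itv /= /interval_length => /andP[z1 _] /andP[_ z2]; lra.
have UV' : val U <> val V by move=> /val_inj.
have [] := gap_order (lacuna_val U) (lacuna_val V) UV'; exact: far.
Qed.

Lemma long_cells_count n (l : seq (set_type (cell_summands a b p w))) : uniq l ->
  (forall nI, nI \in l -> cell_scale lambda n * (b - a) < interval_length (val nI).2) ->
  (size l <= cell_count p n)%N.
Proof.
move=> ul long; apply: leq_trans (cell_count_sum hF n).
pose t := [seq (m, cell a b w m u) | m <- iota 0 n, u <- words p m].
have -> : (\sum_(0 <= m < n) cell_count p m)%N = size t.
  rewrite size_allpairs_dep sumnE big_map /index_iota subn0.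
  by apply: eq_bigr => m _; rewrite words_size.
apply: (size_le_inj_in (f := val) ul) => [x y _ _ /val_inj //|nI nIl].
have cnI := cell_val nI; have := long _ nIl; rewrite (cells_length hF cnI).
rewrite ltr_pM2r // => sc; case: cnI => s Hs sE.
have [u un uE] := cells_cell hF Hs; rewrite [val nI]surjective_pairing -sE uE.
apply/allpairsPdep; exists (val nI).1, u; split=> //.
rewrite mem_iota add0n /= ltnNge; apply/negP => nm.
by have := cell_scale_anti hF nm; rewrite leNgt sc.
Qed.

Lemma summands_count n (l : seq (summand a b p w)) : uniq l ->
  (forall k, k \in l ->
    cell_scale lambda n * (b - a) < interval_length (summand_interval k)) ->
  (size l <= 2 * cell_count p n)%N.
Proof.
move=> ul long.
pose left (k : summand a b p w) := if k is inl U then Some U else None : option (set_type (lacunae a b p w)).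
pose right (k : summand a b p w) := if k is inr nI then Some nI else None
  : option (set_type (cell_summands a b p w)).
have -> : size l = (size (pmap left l) + size (pmap right l))%N.
  by elim: l {ul long} => //= -[U|nI] l -> //=; rewrite addnS.
rewrite mul2n -addnn leq_add //.
  apply: lacunae_count.
    by apply: (pmap_uniq (g := inl)) => // -[].
  by move=> U; rewrite mem_pmap => /mapP[[V|//] Vl [->]]; exact: long Vl.
apply: long_cells_count.
  by apply: (pmap_uniq (g := inr)) => // -[].
by move=> U; rewrite mem_pmap => /mapP[[//|V] Vl [->]]; exact: long Vl.
Qed.

Lemma boundary_count n (l : seq J) : uniq l ->
  (forall j, j \in l -> cell_scale lambda n * (b - a) < len j) ->
  (size l <= cell_count p n.+2)%N.
Proof.
move=> ul long; apply: leq_trans (cell_count_double hF n.+1).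
apply: (@leq_trans (2 * (2 * cell_count p n))); last first.
  by rewrite leq_mul2l (cell_count_double hF).
have half (i : 'I_2) : (count (fun j : J => j.2 == i) l <= 2 * cell_count p n)%N.
  rewrite -size_filter -(size_map (fun j : J => j.1)); apply: summands_count.
    rewrite map_inj_in_uniq ?filter_uniq // => -[k i1] [k' i2].
    by rewrite !mem_filter /= => /andP[/eqP -> _] /andP[/eqP -> _] ->.
  by move=> _ /mapP[j + ->]; rewrite mem_filter => /andP[_ /long].
have -> : size l = (count (fun j : J => j.2 == ord0) l + count (fun j : J => j.2 == ord_max) l)%N.
  rewrite -(count_predC (fun j : J => j.2 == ord0)); congr addn; apply: eq_count => -[k i].
  by rewrite /=; case: i => -[|[|]].
by rewrite [leqRHS]mul2n -addnn leq_add.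
Qed.

Lemma boundary_cells n : exists l : seq J, [/\ uniq l, size l = cell_count p n &
  forall j, j \in l -> len j = cell_scale lambda n * (b - a)].
Proof.
pose s := [seq (n, cell a b w n u) | u <- words p n].
pose t : seq (set_type (cell_summands a b p w)) := pmap insub s.
pose f (nI : set_type (cell_summands a b p w)) : J := (inr nI, ord0).
have us : uniq s.
  rewrite map_inj_in_uniq ?words_uniq // => u v un vn [].
  exact: (cell_inj hF).
exists (map f t); split.
- by rewrite map_inj_uniq ?pmap_sub_uniq // => x y [->].
- rewrite size_map size_pmap_sub -words_size -(size_map (fun u => (n, cell a b w n u))).
  apply/eqP; rewrite -all_count; apply/allP => _ /mapP[u un ->].
  apply/mem_set; exact (cell_mem hF un).
- move=> _ /mapP[nI + ->] /=; rewrite mem_pmap_sub => /mapP[u un nIE].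
  by rewrite nIE; apply: (cells_length hF); exact (cell_mem hF un).
Qed.

Lemma boundary_infinite (l : seq J) : exists j, j \notin l.
Proof.
have [t [ut st _]] := boundary_cells (size l).
apply: contrapT => /forallNP H; have := cell_count_gt hF (size l).
rewrite -st ltnNge uniq_leq_size // => j _; apply: contrapT => /negP; exact: H.
Qed.

Lemma boundary_finite (s : R) : 0 < s -> exists N, forall l : seq J,
  uniq l -> (forall j, j \in l -> s <= len j) -> (size l <= N)%N.
Proof.
move=> s0; have [n ns] : exists n, cell_scale lambda n * (b - a) < s.
  have sab : 0 < s / (b - a) by rewrite divr_gt0.
  have := @cvg_expr R 2^-1; rewrite ger0_norm // invf_lt1 // ltr1n => /(_ isT).
  move=> /cvgrPdist_lt/(_ _ sab)[n _ /(_ n (leqnn n))] /=.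
  rewrite sub0r normrN ger0_norm ?exprn_ge0 // => Hn; exists n.
  rewrite -ltr_pdivlMr //; apply: le_lt_trans Hn; exact: (cell_scale_le hF).
exists (cell_count p n.+2) => l ul ls; apply: boundary_count ul _ => j /ls.
exact: lt_le_trans.
Qed.

End SummandCounting.

(** * Diagonal operators *)

Section SequenceSpace.
Context {R : realType} {J : choiceType}.
Local Notation C := R[i].
Implicit Types (xi eta : J -> C) (u : J -> R).

Definition sqmod (z : C) : R := complex.Re z ^+ 2 + complex.Im z ^+ 2.

Lemma sqmod_ge0 z : 0 <= sqmod z.
Proof. by rewrite addr_ge0 ?sqr_ge0. Qed.

Lemma sqmod_eq0 z : sqmod z = 0 -> z = 0.
Proof.
case: z => a b /eqP; rewrite /sqmod /= paddr_eq0 ?sqr_ge0 // !sqrf_eq0.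
by move=> /andP[/eqP-> /eqP->].
Qed.

Lemma mul_conjc (z : C) : z * z^* = (sqmod z)%:C.
Proof.
by case: z => a b; rewrite /sqmod; simpc; congr Complex; rewrite /=; ring.
Qed.

Lemma esum_bound (a : J -> \bar R) (k : R) : 0 <= k -> (forall j, 0 <= a j)%E ->
  (\esum_(j in setT) a j < +oo)%E -> (\esum_(j in setT) (k%:E * a j) < +oo)%E.
Proof.
move=> k0 a0 fin; apply: (@le_lt_trans _ _ (k%:E * \esum_(j in setT) a j)%E).
  apply: ge_ereal_sup => _ [X [finX XT] <-].
  rewrite -ge0_mule_fsumr // lee_wpmul2l ?lee_fin //.
  by apply: esum_ge; exists X.
by rewrite lte_mul_pinfty ?lee_fin // ge0_fin_numE ?esum_ge0.
Qed.

Lemma l2P xi : l2 xi <-> (\esum_(j in setT) (sqmod (xi j))%:E < +oo)%E.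
Proof. by []. Qed.

Lemma l2_0 : l2 (cst 0 : J -> C).
Proof. by apply/l2P; rewrite esum1 // => j _; rewrite /sqmod /= expr0n /= addr0. Qed.

Lemma l2_lin (c : C) xi eta : l2 xi -> l2 eta -> l2 (fun j => c * xi j + eta j).
Proof.
move=> Hxi Heta; apply/l2P.
apply: (@le_lt_trans _ _ (\esum_(j in setT)
  (((2 * sqmod c)%:E * (sqmod (xi j))%:E) + (2%:E * (sqmod (eta j))%:E)))%E).
  apply: le_esum => j _; rewrite -!EFinM -EFinD lee_fin.
  case: c (xi j) (eta j) => [a b] [x y] [u v]; rewrite /sqmod; simpc => /=.
  have := sqr_ge0 (a * x - b * y - u); have := sqr_ge0 (a * y + b * x - v).
  rewrite !expr2; lra.
have sq0 z : (0 <= (sqmod z)%:E)%E by rewrite lee_fin sqmod_ge0.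
have c0 : 0 <= 2 * sqmod c by rewrite mulr_ge0 ?sqmod_ge0.
rewrite esumD; first last.
- by move=> j _; rewrite mule_ge0.
- by move=> j _; rewrite mule_ge0 // lee_fin.
by rewrite lte_add_pinfty // esum_bound.
Qed.

Lemma real_sum_eq u v : u =1 v -> real_sum u = real_sum v.
Proof. by move=> /funext ->. Qed.

Lemma real_sum_single u j0 : (forall j, j != j0 -> u j = 0) -> real_sum u = u j0.
Proof.
move=> u0; rewrite /real_sum.
have single (a : J -> \bar R) : (forall j, 0 <= a j)%E ->
    (forall j, j != j0 -> a j = 0)%E -> (\esum_(j in setT) a j)%E = a j0.
  move=> a0 aj; rewrite -(esum_set1 (a0 j0)) [RHS]esum_mkcond.
  apply: eq_esum => j _; case: ifPn => // /negP; rewrite inE => /eqP jj.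
  exact: aj.
rewrite !single => [|j|j jj|j|j jj]; rewrite ?funepos_ge0 ?funeneg_ge0 //.
- rewrite funeposE funenegE /=; have [u0'|u0'] := leP (u j0) 0.
    by rewrite max_r ?max_l ?lee_fin ?oppr_ge0 //= sub0r opprK.
  by rewrite max_l ?max_r ?lee_fin ?oppr_le0 ?(ltW u0') //= subr0.
- by rewrite funenegE /= u0 // oppr0 maxxx.
- by rewrite funeposE /= u0 // maxxx.
Qed.

Lemma real_sum_ge0 u : (forall j, 0 <= u j) -> 0 <= real_sum u.
Proof.
move=> u0; rewrite /real_sum [X in _ - fine X]esum1 ?subr0.
  by rewrite fine_ge0 // esum_ge0 // => j _; rewrite funepos_ge0.
by move=> j _; rewrite funenegE max_r // lee_fin oppr_le0.
Qed.

Lemma real_sum_le0_eq0 u : (forall j, u j <= 0) ->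
  (\esum_(j in setT) (- u j)%:E < +oo)%E -> 0 <= real_sum u -> u =1 cst 0.
Proof.
move=> u0 fin; rewrite /real_sum [X in fine X - _]esum1; last first.
  by move=> j _; rewrite funeposE max_r // lee_fin.
rewrite (eq_esum (b := fun j => (- u j)%:E)); last first.
  by move=> j _; rewrite funenegE max_l // lee_fin oppr_ge0.
have nu0 j : (0 <= (- u j)%:E)%E by rewrite lee_fin oppr_ge0.
rewrite sub0r oppr_ge0 -lee_fin fineK ?ge0_fin_numE ?esum_ge0 // => le0 j.
apply/eqP; rewrite eq_le u0 /= -oppr_le0 -lee_fin (le_trans _ le0) //.
apply: esum_ge; exists [set j]; last by rewrite fsbig_set1.
by split => //; exact: finite_set1.
Qed.

Lemma real_sum_reindex (e e' : J -> J) u : cancel e e' -> cancel e' e ->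
  real_sum (u \o e) = real_sum u.
Proof.
move=> ee' e'e; have bij : set_bij setT setT e.
  split=> //.
  - by move=> x y _ _ /(can_inj ee').
  - by move=> y _; exists (e' y).
rewrite /real_sum; congr (fine _ - fine _).
- rewrite [RHS](reindex_esum setT setT e _ bij).
  by apply: eq_esum => j _; rewrite !funeposE.
- rewrite [RHS](reindex_esum setT setT e _ bij).
  by apply: eq_esum => j _; rewrite !funenegE.
Qed.

Lemma inner_eq xi eta xi' eta' :
  (forall j, xi j * (eta j)^* = xi' j * (eta' j)^*) -> inner xi eta = inner xi' eta'.
Proof. by move=> H; congr Complex; apply: real_sum_eq => j; rewrite H. Qed.

Lemma inner_single xi eta j0 : (forall j, j != j0 -> xi j * (eta j)^* = 0) ->
  inner xi eta = xi j0 * (eta j0)^*.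
Proof.
move=> H; rewrite /inner !(@real_sum_single _ j0) => [|j jj|j jj].
- by case: (xi j0 * _).
- by rewrite H.
- by rewrite H.
Qed.

Lemma inner_reindex (e e' : J -> J) xi eta : cancel e e' -> cancel e' e ->
  inner (xi \o e) (eta \o e) = inner xi eta.
Proof.
move=> ee' e'e; congr Complex.
  exact: (real_sum_reindex (fun j => complex.Re (xi j * (eta j)^*)) ee' e'e).
exact: (real_sum_reindex (fun j => complex.Im (xi j * (eta j)^*)) ee' e'e).
Qed.

Lemma l2_reindex (e e' : J -> J) xi : cancel e e' -> cancel e' e ->
  l2 xi -> l2 (xi \o e).
Proof.
move=> ee' e'e /l2P; have bij : set_bij setT setT e.
  split=> //.
  - by move=> x y _ _ /(can_inj ee').
  - by move=> y _; exists (e' y).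
by rewrite (reindex_esum setT setT e _ bij).
Qed.

Lemma real_sum0 u : u =1 cst 0 -> real_sum u = 0.
Proof.
by move=> u0; rewrite /real_sum !esum1 ?subr0 // => j _;
  rewrite ?funeposE ?funenegE /= u0 ?oppr0 ?oppe0 maxxx.
Qed.

Lemma inner_ge0 xi eta (u : J -> R) : (forall j, xi j * (eta j)^* = (u j)%:C) ->
  (0 <= inner xi eta) = (0 <= real_sum u).
Proof.
move=> H; rewrite lecE /= real_sum0 ?eqxx => [|j]; last by rewrite H.
by congr (0 <= _); apply: real_sum_eq => j; rewrite H.
Qed.

Definition delta (j : J) : J -> C := fun i => (i == j)%:R.

Lemma l2_delta j : l2 (delta j).
Proof.
apply/l2P; apply: (@le_lt_trans _ _ (\esum_(i in [set j]) 1%:E)%E).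
  rewrite [leRHS]esum_mkcond; apply: le_esum => i _.
  rewrite /delta /sqmod; case: eqP => [->|ij].
    by rewrite mem_set //= expr1n expr0n addr0.
  by rewrite /= expr0n addr0; case: ifP.
by rewrite esum_set1 ?ltry.
Qed.

End SequenceSpace.

Section DiagonalOperators.
Context {R : realType} {J : choiceType}.
Local Notation C := R[i].
Implicit Types (d : J -> R) (D A : graph R J).

Definition diag_op d : graph R J :=
  [set xc | [/\ l2 xc.1, l2 xc.2 & forall j, xc.2 j = (d j)%:C * xc.1 j]].

Lemma diag_op_operator d : is_operator (diag_op d).
Proof.
split.
- by move=> xi chi [].
- move=> xi chi chi' [_ _ /= H] [_ _ /= H'].
  by apply/funext => j; rewrite H H'.
- by split => [||j] /=; rewrite ?mulr0 //; exact: l2_0.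
- move=> c xi chi xi' chi' [/= ? ? H] [/= ? ? H'].
  split => [||j] /=; [exact: l2_lin | exact: l2_lin | rewrite H H'; ring].
Qed.

Lemma conj_realC (x : R) : (x%:C^*)%R = x%:C :> C.
Proof. by congr Complex; rewrite /= oppr0. Qed.

Lemma diag_op_delta d j : diag_op d (delta j, fun i => (d j)%:C * delta j i).
Proof.
split => [||i] /=; [exact: l2_delta | | ].
  have : l2 (fun i => (d j)%:C * delta j i + cst 0 i).
    by apply: l2_lin; [exact: l2_delta | exact: l2_0].
  by congr l2; apply/funext => i; rewrite addr0.
by rewrite /delta; case: eqP => [->|]; rewrite ?mulr0.
Qed.

Lemma inner_delta d j (eta zeta : J -> C) :
  inner (fun i => (d j)%:C * delta j i) eta = inner (delta j) zeta ->
  zeta j = (d j)%:C * eta j.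
Proof.
rewrite !(@inner_single _ _ _ _ j) => [|i /negPf ij|i /negPf ij]; rewrite /delta ?eqxx ?ij;
  [| by rewrite mul0r | by rewrite mulr0 mul0r].
rewrite mulr1 mul1r => H; apply: (can_inj conjCK).
by rewrite -H rmorphM /= conj_realC.
Qed.

Lemma inner_diag d (xi eta chi zeta : J -> C) :
  (forall j, chi j = (d j)%:C * xi j) -> (forall j, zeta j = (d j)%:C * eta j) ->
  inner chi eta = inner xi zeta.
Proof.
move=> H1 H2; apply: inner_eq => j; rewrite H1 H2 rmorphM /= conj_realC; ring.
Qed.

Lemma diag_op_adjoint d : op_adjoint (diag_op d) = diag_op d.
Proof.
apply/seteqP; split=> -[eta zeta] [/= Heta Hzeta H]; split=> //=.
  by move=> j; apply: inner_delta; apply: H; exact: diag_op_delta.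
by move=> xi chi [/= _ _ Hchi]; exact: inner_diag Hchi H.
Qed.

Lemma diag_op_positive d : (forall j, 0 <= d j) -> op_positive (diag_op d).
Proof.
move=> d0 xi chi [/= _ _ H]; rewrite (@inner_ge0 _ _ _ _ (fun j => d j * sqmod (xi j))).
  by apply: real_sum_ge0 => j; rewrite mulr_ge0 ?sqmod_ge0.
by move=> j; rewrite H -mulrA mul_conjc; simpc.
Qed.

Lemma positive_negative_eigenvector A (y : J -> C) (c : R) : op_positive A -> 0 < c ->
  l2 y -> A (y, fun j => - c%:C * y j) -> y = cst 0.
Proof.
move=> Apos c0 Hy /Apos; rewrite (@inner_ge0 _ _ _ _ (fun j => - (c * sqmod (y j)))).
  move=> /real_sum_le0_eq0 H; apply/funext => j; apply: sqmod_eq0.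
  have : - (c * sqmod (y j)) = 0.
    apply: H => [i|]; first by rewrite oppr_le0 mulr_ge0 ?sqmod_ge0 // ltW.
    under eq_esum do rewrite opprK EFinM.
    by apply: esum_bound => //; [exact: ltW | move=> i; rewrite lee_fin sqmod_ge0].
  by move/eqP; rewrite oppr_eq0 mulf_eq0 gt_eqF //= => /eqP.
by move=> j; rewrite -mulrA mul_conjc; simpc.
Qed.

(* If [A] is a positive square root of the square of [diag_op d], then
   [y = A e_j - d_j e_j] satisfies [A y = - d_j y], whence [y = 0]; self-adjointness
   then determines [A] from its values on the basis vectors [e_j]. *)
Lemma op_abs_diag D d : (forall j, 0 < d j) -> op_adjoint D = D ->
  op_comp D D = op_comp (diag_op d) (diag_op d) -> op_abs D = diag_op d.
Proof.
move=> d0 Dadj DD; rewrite /op_abs; apply: get_unique.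
  split; rewrite ?Dadj ?DD //; [exact: diag_op_operator | exact: diag_op_adjoint|].
  by apply: diag_op_positive => j; exact: ltW.
move=> A [Aop Aadj Apos]; rewrite Dadj DD => AA.
have Adelta j : A (delta j, fun i => (d j)%:C * delta j i).
  have : op_comp A A (delta j, fun i => (d j)%:C * ((d j)%:C * delta j i)).
    rewrite AA; exists (fun i => (d j)%:C * delta j i); first exact: diag_op_delta.
    have [_ H _] := diag_op_delta d j; split => //=.
    - have : l2 (fun i => (d j)%:C * ((d j)%:C * delta j i) + cst 0 i).
        by apply: l2_lin => //; exact: l2_0.
      by congr l2; apply/funext => i; rewrite addr0.
    - by move=> i; rewrite /delta; case: eqP => [->|_]; rewrite ?mulr0.
  move=> [/= eta A1 A2].
  have := op_lin Aop (- (d j)%:C) A1 A2.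
  set y := (fun i => _ + eta i) => Ay.
  have y0 : y = cst 0.
    apply: (positive_negative_eigenvector Apos (d0 j)).
      by have [] := op_l2 Aop Ay.
    move: Ay; congr (A (_, _)); apply/funext => i; rewrite /y; ring.
  suff <- : eta = fun i => (d j)%:C * delta j i by [].
  apply/funext => i; have := congr1 (@^~ i) y0; rewrite /y /= mulNr addrC.
  by move/eqP; rewrite subr_eq0 => /eqP.
have Adiag xi chi : A (xi, chi) -> diag_op d (xi, chi).
  move=> Axc; have [Hxi Hchi] := op_l2 Aop Axc; split=> //= j.
  move: Axc; rewrite -Aadj => -[/= _ _ H]; apply: inner_delta; exact: H.
apply/seteqP; split => -[xi chi]; first exact: Adiag.
move=> [/= Hxi Hchi H]; rewrite -Aadj; split => //= xi' chi' /Adiag[/= _ _ H'].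
exact: inner_diag H' H.
Qed.

End DiagonalOperators.

(** * Eigenvalue sequences *)

Section FlippedDiagonal.
Context {R : realType} {K : choiceType}.
Local Notation C := R[i].
Variable r : K -> R.

Definition flip_op : graph R (K * 'I_2)%type :=
  [set xc | [/\ l2 xc.1, l2 xc.2 &
     forall k i, xc.2 (k, i) = (r k)%:C * xc.1 (k, rev_ord i)]].

Let swap (j : K * 'I_2) := (j.1, rev_ord j.2).

Let swapK : cancel swap swap.
Proof. by move=> [k i]; rewrite /swap /= rev_ordK. Qed.

Lemma flip_op_adjoint : op_adjoint flip_op = flip_op.
Proof.
apply/seteqP; split=> -[eta zeta] [/= Heta Hzeta H]; split=> //=.
- move=> k i; pose d (j : K * 'I_2) := r j.1.
  have [dl2 dl2' _] := diag_op_delta d (k, i).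
  have flip : flip_op (delta (k, i),
      (fun j => (r k)%:C * delta (k, i) j) \o swap).
    split; [exact: dl2 | exact: l2_reindex swapK swapK dl2' | ].
    move=> k' i'; rewrite /swap /delta /=.
    by case: (eqVneq k' k) => [->//|/negPf kk]; rewrite !xpair_eqE kk !mulr0.
  have := H _ _ flip.
  rewrite -(inner_reindex _ eta swapK swapK).
  have -> : ((fun j => (r k)%:C * delta (k, i) j) \o swap) \o swap =
      (fun j => (r k)%:C * delta (k, i) j).
    by apply/funext => j; rewrite /comp swapK.
  by move=> /(@inner_delta _ _ d (k, i)) ->.
- move=> xi chi [/= _ _ Hchi].
  rewrite -(inner_reindex xi zeta swapK swapK).
  apply: inner_eq => -[k i] /=; rewrite /swap /= Hchi H rev_ordK rmorphM /=.
  by rewrite conj_realC; ring.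
Qed.

Lemma flip_op_square :
  op_comp flip_op flip_op = op_comp (diag_op (fun j => r j.1)) (diag_op (fun j => r j.1)).
Proof.
apply/seteqP; split=> -[xi zeta] /= [eta [/= Hxi Heta H] [/= _ Hzeta H']].
all: have Heta' := l2_reindex swapK swapK Heta.
- exists (eta \o swap).
    by split=> [||[k i]]; [exact: Hxi | exact: Heta' | rewrite /= /swap /= H rev_ordK].
  by split=> [||[k i]]; [exact: Heta' | exact: Hzeta | rewrite /= H'].
- exists (eta \o swap).
    by split=> [||k i]; [exact: Hxi | exact: Heta' | rewrite /= H].
  by split=> [||k i]; [exact: Heta' | exact: Hzeta | rewrite /= H' /swap /= rev_ordK].
Qed.

End FlippedDiagonal.

Lemma fractal_diracE (R : realType) (a b : R) (p : nat -> nat)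
    (w : nat -> nat -> R -> R) :
  @fractal_dirac R a b p w = flip_op (fun k => (interval_length (summand_interval k))^-1).
Proof.
have row (k : summand a b p w) i (xi : bd_index a b p w -> R[i]) :
    \sum_(j < 2) interval_dirac (summand_interval k) i j * xi (k, j) =
    ((interval_length (summand_interval k))^-1)%:C * xi (k, rev_ord i).
  rewrite big_ord_recl big_ord1 !mxE.
  have -> : rev_ord i = if i == ord0 then lift ord0 ord0 else ord0.
    by apply/val_inj; case: i => -[|[|]].
  case: i => -[|[|//]] /= hi; rewrite ?eqxx /=.
    by rewrite mulr0 mul0r add0r mulr1.
  by rewrite mulr0 mul0r addr0 mulr1.
apply/seteqP; split=> -[xi chi] [/= ? ? H]; split=> //= k i.
  by rewrite H row.
by rewrite H row.
Qed.

Section SortedEnumeration.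
Context {R : realType} {J : choiceType}.
Variable len : J -> R.
Hypothesis infJ : forall l : seq J, exists j, j \notin l.
Hypothesis len_gt0 : forall j, 0 < len j.
Hypothesis fin_ge : forall s : R, 0 < s -> exists N, forall l : seq J,
  uniq l -> (forall j, j \in l -> s <= len j) -> (size l <= N)%N.

Lemma seq_max (l : seq J) : l != [::] ->
  exists2 j, j \in l & forall i, i \in l -> len i <= len j.
Proof.
elim: l => // j l IH _; have [->|/IH[k kl kmax]] := eqVneq l [::].
  by exists j; rewrite ?mem_head // => i; rewrite inE => /eqP ->.
have [jk|/ltW kj] := leP (len j) (len k).
  exists k; first by rewrite inE kl orbT.
  by move=> i; rewrite inE => /predU1P[->|/kmax].
exists j; first exact: mem_head.
by move=> i; rewrite inE => /predU1P[->|/kmax/le_trans] //; exact.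
Qed.

Lemma exists_longest_outside (l : seq J) :
  exists2 j, j \notin l & forall i, i \notin l -> len i <= len j.
Proof.
have [j0 j0l] := infJ l; have [N HN] := fin_ge (len_gt0 j0).
pose good (s : seq J) := [/\ uniq s, (forall j, j \in s -> j \notin l) &
  (forall j, j \in s -> len j0 <= len j)].
have [s [[us sl sj0] smax]] : exists s, good s /\ forall t, good t -> (size t <= size s)%N.
  have exP : exists n, `[< exists2 s, good s & size s = n >].
    by exists 0%N; apply/asboolP; exists [::].
  have bP n : `[< exists2 s, good s & size s = n >] -> (n <= N)%N.
    by move=> /asboolP[s [us _ sj0] <-]; exact: HN.
  case: (ex_maxnP exP bP) => n /asboolP[s gs <-] nmax; exists s; split => // t gt.
  by apply: nmax; apply/asboolP; exists t.
have full i : i \notin l -> len j0 <= len i -> i \in s.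
  move=> il j0i; apply: contraT => ins.
  suff /smax : good (i :: s) by rewrite ltnn.
  split=> [|j|j]; first by rewrite /= ins.
    by rewrite inE => /predU1P[->|/sl].
  by rewrite inE => /predU1P[->|/sj0].
have [|j js jmax] := @seq_max s.
  by apply: contraTneq (full j0 j0l (lexx _)) => ->.
exists j; first exact: sl.
move=> i il; have [/(full i il)/jmax //|/ltW ij0] := leP (len j0) (len i).
by apply: le_trans ij0 _; exact: sj0.
Qed.

Lemma sorted_enumeration : exists phi : nat -> J,
  [/\ injective phi, (forall j, exists n, phi n = j) &
      forall m n, (m <= n)%N -> len (phi n) <= len (phi m)].
Proof.
have [pick pickP] := choice (fun l => let: ex_intro2 j jl jmax :=
  exists_longest_outside l in ex_intro (fun j => j \notin l /\
    forall i, i \notin l -> len i <= len j) j (conj jl jmax)).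
pose prefix := fix prefix n := if n is m.+1 then rcons (prefix m) (pick (prefix m)) else [::].
pose phi n := pick (prefix n).
have prefixP m n : (m < n)%N -> phi m \in prefix n.
  elim: n => // n IH; rewrite ltnS leq_eqVlt mem_rcons inE => /predU1P[->|/IH ->].
    by rewrite eqxx.
  by rewrite orbT.
have prefixN m n : (n <= m)%N -> phi m \notin prefix n.
  move=> nm; have [+ _] := pickP (prefix m); apply: contra.
  rewrite -/(phi m); move: (phi m) => j; rewrite -(subnK nm).
  by elim: (m - n)%N => //= k IH /IH; rewrite mem_rcons inE => ->; rewrite orbT.
have phi_inj : injective phi.
  move=> m n mn; apply/eqP; case: ltngtP => // lt.
    by have := prefixN n n (leqnn n); rewrite -mn prefixP.
  by have := prefixN m m (leqnn m); rewrite mn prefixP.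
have phi_max n j : j \notin prefix n -> len j <= len (phi n).
  by have [_] := pickP (prefix n); exact.
have prefix_phi n j : j \in prefix n -> exists k, phi k = j.
  elim: n => //= n IH; rewrite mem_rcons inE => /predU1P[->|/IH //].
  by exists n.
exists phi; split=> // [j|m n mn].
  have [//|nj] := pselect (exists n, phi n = j).
  have [N HN] := fin_ge (len_gt0 j).
  suff : (N.+1 <= N)%N by rewrite ltnn.
  rewrite -[X in (X <= _)%N](size_iota 0) -(size_map phi); apply: HN.
    by rewrite map_inj_uniq ?iota_uniq.
  move=> _ /mapP[n _ ->]; apply: phi_max.
  by apply: contra_notN nj; exact: prefix_phi.
by apply: phi_max; exact: prefixN.
Qed.

End SortedEnumeration.

Section EigenvalueSequences.
Context {R : realType} {J : choiceType}.
Local Notation C := R[i].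

Lemma lin_indep_leq (m : nat) (e : 'I_m -> J -> C) (s : seq J) : lin_indep e ->
  (forall i j, j \notin s -> e i j = 0) -> (m <= size s)%N.
Proof.
move=> ind supp; pose A := \matrix_(i < m, l < size s) e i (tnth (in_tuple s) l).
rewrite leqNgt; apply/negP => sm.
have ker0 : kermx A != 0.
  by rewrite -mxrank_eq0 mxrank_ker subn_eq0 -ltnNge (leq_ltn_trans (rank_leq_col A)).
have /rowV0Pn[v /sub_kermxP vA v0] := ker0.
move/eqP: v0; apply; apply/rowP => i; rewrite mxE.
apply: (ind (v 0)) => j; have [js|js] := boolP (j \in s); last first.
  by rewrite big1 // => l _; rewrite supp // mulr0.
have /tnthP[l ->] : j \in in_tuple s by [].
have := congr1 (fun M : 'rV_(size s) => M 0 l) vA; rewrite !mxE => vAl.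
by rewrite -[RHS]vAl; apply: eq_bigr => k _; rewrite mxE.
Qed.

Lemma eigenvalue_sequence_leq (T : graph R J) (mu mu' : nat -> R) n :
  is_eigenvalue_sequence T mu -> is_eigenvalue_sequence T mu' ->
  (forall i, (i < n)%N -> mu i = mu' i) -> mu' n <= mu n.
Proof.
move=> [decr H] [decr' H'] agree; rewrite leNgt; apply/negP => lt.
pose t := [seq i <- iota 0 n | mu' i == mu' n].
have tn i : i \in t -> (i < n)%N by rewrite mem_filter mem_iota => /andP[_].
have ut : uniq (n :: t).
  by rewrite /= filter_uniq ?iota_uniq // andbT; apply/negP => /tn; rewrite ltnn.
have [e indep eigen] : exists2 e : 'I_(size t).+1 -> J -> C, lin_indep e &
    forall i, T (e i, fun j => (mu' n)%:C * e i j).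
  apply/H'; exists (fun i => nth 0%N (n :: t) i) => [i k /eqP|i].
    by rewrite nth_uniq // => /eqP/val_inj.
  congr (_ %:C); have : nth 0%N (n :: t) i \in n :: t by rewrite mem_nth.
  by rewrite inE mem_filter => /predU1P[->|/andP[/eqP]].
have [|s s_inj smu] := (H (mu' n)%:C (size t).+1).1; first by exists e.
have : uniq (map s (enum 'I_(size t).+1)) by rewrite map_inj_uniq ?enum_uniq.
move=> us; suff : (size (map s (enum 'I_(size t).+1)) <= size t)%N.
  by rewrite size_map size_enum_ord ltnn.
apply: uniq_leq_size us _.
move=> _ /mapP[i _ ->]; have [smui] : mu (s i) = mu' n by have [] := smu i.
have sin : (s i < n)%N.
  rewrite ltnNge; apply/negP => /decr; rewrite smui leNgt => /negP; exact.
by rewrite mem_filter mem_iota add0n sin -agree // smui eqxx.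
Qed.

Lemma eigenvalue_sequence_unique (T : graph R J) (mu mu' : nat -> R) :
  is_eigenvalue_sequence T mu -> is_eigenvalue_sequence T mu' -> mu = mu'.
Proof.
move=> H H'; apply/funext => n; elim/ltn_ind: n => n IH.
apply/eqP; rewrite eq_le; apply/andP; split.
  by apply: (eigenvalue_sequence_leq H' H) => i /IH.
exact: (eigenvalue_sequence_leq H H').
Qed.

Lemma eigenvalue_sequence_inv_diag (len : J -> R) (phi : nat -> J) :
  (forall j, 0 < len j) -> injective phi -> (forall j, exists n, phi n = j) ->
  (forall m n, (m <= n)%N -> len (phi n) <= len (phi m)) ->
  (forall s : R, 0 < s -> exists n, len (phi n) < s) ->
  eigenvalue_sequence (op_inv (diag_op (fun j => (len j)^-1))) = len \o phi.
Proof.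
move=> len0 phi_inj phi_surj decr to0; set T := op_inv _.
have Tdelta j : T (delta j, fun i => (len j)%:C * delta j i).
  have [l1 l2' _] := diag_op_delta len j; split; [exact: l2'|exact: l1|move=> i /=].
  rewrite /delta; case: eqP => [->|_]; rewrite ?mulr0 // !mulr1 -rmorphM /=.
  by rewrite mulVf // gt_eqF.
have eigen alpha (e : J -> C) j : T (e, fun i => alpha * e i) ->
    e j != 0 -> alpha = (len j)%:C.
  move=> [/= _ _ /(_ j) H] ej0.
  apply: (mulIf ej0); rewrite [in RHS]H [RHS]mulrA -rmorphM /= divff ?gt_eqF //.
  by rewrite mul1r.
suff isE : is_eigenvalue_sequence T (len \o phi).
  by apply: (get_unique isE) => mu' Hmu'; exact: eigenvalue_sequence_unique Hmu' isE.
split=> [m n|alpha m]; first exact: decr.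
split=> [[e ind eT]|[s s_inj slen]]; last first.
  exists (fun i => delta (phi (s i))) => [c c0 i|i]; last by rewrite -(slen i); exact: Tdelta.
  have := c0 (phi (s i)); rewrite (bigD1 i) //= /delta eqxx mulr1 big1 ?addr0 //.
  by move=> k ki; rewrite (inj_eq phi_inj) (inj_eq s_inj) eq_sym (negPf ki) mulr0.
have [m0|m0] := posnP m.
  by subst m; exists (fun=> 0%N) => [[]|[]].
have [j ej] : exists j, e (Ordinal m0) j != 0.
  apply: contrapT => ne.
  suff /(_ (Ordinal m0))/eqP : forall i, (i == Ordinal m0)%:R = 0 :> C.
    by rewrite eqxx oner_eq0.
  apply: ind => j; rewrite (bigD1 (Ordinal m0)) //= ?eqxx mul1r big1 ?addr0; last first.
    by move=> i /negPf ->; rewrite mul0r.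
  by apply: contrapT => /eqP ej; apply: ne; exists j.
have alphaE := eigen _ _ _ (eT _) ej.
have [N lenN] := to0 _ (len0 j).
pose t := [seq n <- iota 0 N | len (phi n) == len j].
have mt : (m <= size t)%N.
  rewrite -(size_map phi); apply: (lin_indep_leq ind) => i k kt.
  apply: contraNeq kt => /(eigen _ _ _ (eT i)); rewrite alphaE => -[lenjk].
  have [n nk] := phi_surj k; apply/mapP; exists n => //.
  rewrite mem_filter nk -lenjk eqxx mem_iota add0n /= ltnNge; apply/negP => Nn.
  by have := decr _ _ Nn; rewrite nk -lenjk leNgt lenN.
exists (fun i : 'I_m => nth 0%N t i) => [i k /eqP|i].
  rewrite nth_uniq ?filter_uniq ?iota_uniq //; first by move/eqP/val_inj.
    exact: leq_trans (ltn_ord _) mt.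
  exact: leq_trans (ltn_ord _) mt.
have : nth 0%N t i \in t by rewrite mem_nth // (leq_trans (ltn_ord _) mt).
by rewrite mem_filter alphaE /= => /andP[/eqP -> _].
Qed.

End EigenvalueSequences.

Section EigenvalueCounting.
Context {R : realType} {J : choiceType}.
Variable len : J -> R.
Hypothesis infJ : forall l : seq J, exists j, j \notin l.
Hypothesis len_gt0 : forall j, 0 < len j.
Hypothesis fin_ge : forall s : R, 0 < s -> exists N, forall l : seq J,
  uniq l -> (forall j, j \in l -> s <= len j) -> (size l <= N)%N.

Local Notation mu := (eigenvalue_sequence (op_inv (diag_op (fun j => (len j)^-1)))).

Lemma eigenvalue_enumeration : exists phi : nat -> J,
  [/\ injective phi, (forall j, exists n, phi n = j),
      (forall m n, (m <= n)%N -> len (phi n) <= len (phi m)) & mu = len \o phi].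
Proof.
have [phi [phi_inj phi_surj decr]] := sorted_enumeration infJ len_gt0 fin_ge.
exists phi; split => //; apply: eigenvalue_sequence_inv_diag => // s s0.
have [N HN] := fin_ge s0; exists N; rewrite ltNge; apply/negP => sN.
suff : (size (map phi (iota 0 N.+1)) <= N)%N by rewrite size_map size_iota ltnn.
apply: HN; first by rewrite map_inj_uniq ?iota_uniq.
move=> _ /mapP[n + ->]; rewrite mem_iota ltnS => /andP[_ nN].
exact: le_trans sN (decr _ _ nN).
Qed.

Lemma eigenvalue_gt0 n : 0 < mu n.
Proof. by have [phi [_ _ _ ->]] := eigenvalue_enumeration; exact: len_gt0. Qed.

Lemma eigenvalue_anti m n : (m <= n)%N -> mu n <= mu m.
Proof. by have [phi [_ _ decr ->]] := eigenvalue_enumeration; exact: decr. Qed.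

Lemma eigenvalue_ge s (l : seq J) k : uniq l -> (forall j, j \in l -> s <= len j) ->
  (k < size l)%N -> s <= mu k.
Proof.
have [phi [phi_inj phi_surj decr ->]] := eigenvalue_enumeration.
move=> ul ls kl; rewrite leNgt; apply/negP => /= ks.
suff : (size l <= size (map phi (iota 0 k)))%N.
  by rewrite size_map size_iota leqNgt kl.
apply: uniq_leq_size ul _ => j jl; have [n nj] := phi_surj j; apply/mapP; exists n => //.
rewrite mem_iota add0n /= ltnNge; apply/negP => /decr; rewrite nj leNgt.
by rewrite (lt_le_trans ks (ls _ jl)).
Qed.

Lemma eigenvalue_le s M k : (forall l, uniq l -> (forall j, j \in l -> s < len j) ->
  (size l <= M)%N) -> (M <= k)%N -> mu k <= s.
Proof.
have [phi [phi_inj _ decr ->]] := eigenvalue_enumeration.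
move=> H Mk; rewrite leNgt; apply/negP => /= sk.
suff : (size (map phi (iota 0 k.+1)) <= M)%N.
  by rewrite size_map size_iota ltnNge Mk.
apply: H; first by rewrite map_inj_uniq ?iota_uniq.
move=> _ /mapP[n + ->]; rewrite mem_iota ltnS => /andP[_ nk].
exact: lt_le_trans sk (decr _ _ nk).
Qed.

End EigenvalueCounting.

(** * Increments and ratios *)

Section StaircaseIncrements.
Context {R : realType}.
Variables (x y : nat -> R) (f : R -> R) (d C c0 : R) (q : nat -> nat -> R).
Hypothesis d_gt0 : 0 < d.
Hypothesis x_step : forall n, d <= x n.+1 - x n <= C.
Hypothesis xy_step : forall n, x n.+1 - x n <= y n.+1 - y n.
Hypothesis f_le : forall n t, t < x n -> f t <= y n - c0.
Hypothesis f_ge : forall n t, x n.+2 <= t -> y n - c0 <= f t.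
Hypothesis qE : forall m k,
  q m.+1 k = (x (m + k.+1) - x m) / (y (m + k.+1) - y m).

Lemma stair_sub n k : k%:R * d <= x (n + k) - x n <= k%:R * C.
Proof.
elim: k => [|k IH]; first by rewrite addn0 subrr !mul0r lexx.
move: IH (x_step (n + k)%N) => /andP[? ?] /andP[? ?].
by rewrite addnS -natr1 !mulrDl !mul1r; apply/andP; split; lra.
Qed.

Lemma stair_subS n k : 0 < x (n + k.+1) - x n <= y (n + k.+1) - y n.
Proof.
have posx j : 0 < x j.+1 - x j by have := x_step j; have := d_gt0; lra.
elim: k => [|k IH].
  by rewrite addn1 xy_step posx.
have := xy_step (n + k.+1)%N; have := posx (n + k.+1)%N.
rewrite !(addnS _ k.+1); lra.
Qed.

Lemma stair_mono m n : (m <= n)%N -> x m <= x n.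
Proof.
move=> /subnKC <-; have := stair_sub m (n - m)%N.
have : 0 <= (n - m)%:R * d by rewrite mulr_ge0 // ltW.
lra.
Qed.

Lemma stair_lt m n : x m < x n -> (m < n)%N.
Proof. by rewrite ltnNge; apply: contraTN => /stair_mono; rewrite leNgt. Qed.

Lemma stair_unbounded (t : R) : exists n, t < x n.
Proof.
exists (Num.truncn (`|t - x 0%N| / d)).+1.
have := stair_sub 0 (Num.truncn (`|t - x 0%N| / d)).+1; rewrite add0n.
have : `|t - x 0%N| < (Num.truncn (`|t - x 0%N| / d)).+1%:R * d.
  by rewrite -ltr_pdivrMr // truncnS_gt.
have := ler_norm (t - x 0%N); lra.
Qed.

Lemma stair_locate N (t : R) : x N <= t ->
  exists2 n, (N <= n)%N & x n <= t < x n.+1.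
Proof.
move=> xNt; have ex := stair_unbounded t.
case: (ex_minnP ex) => -[|n] tn nmin.
  by move: (le_lt_trans xNt tn); rewrite ltNge stair_mono.
exists n; first by rewrite -ltnS stair_lt // (le_lt_trans xNt).
rewrite tn andbT leNgt; apply/negP => /nmin; by rewrite ltnn.
Qed.

Lemma stair_step_gt0 : 0 < C.
Proof. by have := x_step 0; have := d_gt0; lra. Qed.

Lemma increment_le_of_ratio_ge (r v : R) N : 0 < r ->
  (forall n k, (N <= n)%N -> (N <= k)%N -> r <= q n k) -> r^-1 < v ->
  exists H, forall h, H <= h -> exists T, forall t, T <= t ->
    f (t + h) - f t <= v * h.
Proof.
move=> r0 rq rv; have d0 := d_gt0; have C0 := stair_step_gt0.
have NC0 : 0 <= N%:R * C by rewrite mulr_ge0 // ltW.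
exists (N%:R * C + 4 * C / r / (v - r^-1)) => h Hh; exists (x (N + 2)%N) => t Tt.
have v0 : 0 < v - r^-1 by lra.
have h1 : 4 * C / r <= h * (v - r^-1).
  rewrite -ler_pdivrMr //; lra.
have hN : N%:R * C <= h.
  apply: le_trans Hh; rewrite lerDl !divr_ge0 ?mulr_ge0 // ltW //.
have [n Nn /andP[xnt txn]] := stair_locate Tt.
have [m nm /andP[xmt txm]] : exists2 m, (n <= m)%N & x m <= t + h < x m.+1.
  by apply: stair_locate; lra.
have /subnK n2 : (2 <= n)%N by rewrite (leq_trans _ Nn) // leq_addl.
move: n2; set n0 := (n - 2)%N; rewrite addn2 => nE.
have Nn0 : (N <= n0)%N by rewrite leq_subRL ?(leq_trans _ Nn) ?leq_addl // addnC.
have mlarge : (n0 + N < m.+1)%N.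
  apply: stair_lt; have := stair_sub n0 N; have := stair_sub n0 2.
  by rewrite addn2 nE; lra.
have mE : (n0 + (m - n0).+1 = m.+1)%N.
  by rewrite addnS subnKC // -ltnS (leq_ltn_trans _ mlarge) // leq_addr.
have := rq n0.+1 (m - n0)%N (leqW Nn0).
rewrite qE mE leq_subRL ?(leq_trans (leq_addr N _) (_ : n0 + N <= m)%N) //.
move=> /(_ mlarge) rle.
have := stair_subS n0 (m - n0)%N; rewrite mE => /andP[xp xy].
have yp : 0 < y m.+1 - y n0 by lra.
move: rle; rewrite ler_pdivlMr // mulrC -ler_pdivlMr // => rle.
have fu := f_le txm; have fl : y n0 - c0 <= f t by apply: f_ge; rewrite nE.
have xm1 := x_step m; have x3 := stair_sub n0 3.
move: x3; rewrite addn3 nE => x3.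
have : (x m.+1 - x n0) / r <= (h + 4 * C) / r.
  by rewrite ler_pM2r ?invr_gt0 //; lra.
rewrite (mulrDl h); lra.
Qed.

Lemma increment_ge_of_ratio_le (r v : R) N : 0 < r ->
  (forall n k, (N <= n)%N -> (N <= k)%N -> q n k <= r) -> v < r^-1 ->
  exists H, forall h, H <= h -> exists T, forall t, T <= t ->
    v * h <= f (t + h) - f t.
Proof.
move=> r0 rq rv; have d0 := d_gt0; have C0 := stair_step_gt0.
have NC0 : 0 <= N%:R * C by rewrite mulr_ge0 // ltW.
exists (N%:R * C + 5 * C + 4 * C / r / (r^-1 - v)) => h Hh.
exists (x N) => t Tt.
have v0 : 0 < r^-1 - v by lra.
have rest0 : 0 <= 4 * C / r / (r^-1 - v) by rewrite !divr_ge0 ?mulr_ge0 // ltW.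
have h1 : 4 * C / r <= h * (r^-1 - v).
  rewrite -ler_pdivrMr //; lra.
have [n Nn /andP[xnt txn]] := stair_locate Tt.
have [m nm /andP[xmt txm]] : exists2 m, (n <= m)%N & x m <= t + h < x m.+1.
  by apply: stair_locate; lra.
have mlarge : (n + (N + 4) < m.+1)%N.
  apply: stair_lt; have := stair_sub n (N + 4)%N; rewrite natrD mulrDl; lra.
have mE : (n.+1 + (m - n - 4).+1 = m - 2)%N by move: mlarge; clear; lia.
have kN : (N <= m - n - 4)%N by move: mlarge; clear; lia.
have := rq n.+2 (m - n - 4)%N (leqW (leqW Nn)) kN.
rewrite qE mE => rle.
have := stair_subS n.+1 (m - n - 4); rewrite mE => /andP[xp xy].
have yp : 0 < y (m - 2)%N - y n.+1 by lra.
move: rle; rewrite ler_pdivrMr // mulrC -ler_pdivrMr // => rle.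
have fu := f_le txn.
have m2 : ((m - 2).+2 = m)%N by move: mlarge; clear; lia.
have fl : y (m - 2)%N - c0 <= f (t + h) by apply: f_ge; rewrite m2.
have x3 := stair_sub (m - 2)%N 3; have x1 := x_step n.
have m3 : (m - 2 + 3 = m.+1)%N by move: mlarge; clear; lia.
move: x3; rewrite m3 => x3.
have : (h - 4 * C) / r <= (x (m - 2)%N - x n.+1) / r.
  by rewrite ler_pM2r ?invr_gt0 //; lra.
rewrite (mulrBl _ h); lra.
Qed.

Lemma iterated_increment_le (h v T : R) : 0 <= h ->
  (forall t, T <= t -> f (t + h) - f t <= v * h) ->
  forall j t, T <= t -> f (t + j%:R * h) - f t <= v * (j%:R * h).
Proof.
move=> h0 H; elim=> [|j IH] t Tt; first by rewrite mul0r addr0; lra.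
have Tj : T <= t + j%:R * h by rewrite (le_trans Tt) // lerDl mulr_ge0.
have := H _ Tj; have := IH _ Tt; rewrite -addrA -natr1 mulrDl mul1r; lra.
Qed.

Lemma iterated_increment_ge (h v T : R) : 0 <= h ->
  (forall t, T <= t -> v * h <= f (t + h) - f t) ->
  forall j t, T <= t -> v * (j%:R * h) <= f (t + j%:R * h) - f t.
Proof.
move=> h0 H; elim=> [|j IH] t Tt; first by rewrite mul0r addr0; lra.
have Tj : T <= t + j%:R * h by rewrite (le_trans Tt) // lerDl mulr_ge0.
have := H _ Tj; have := IH _ Tt; rewrite -addrA -natr1 mulrDl mul1r; lra.
Qed.

(* Covering a block of indices by about (length / h) increments of [f] costs
   only a bounded error, which is negligible for long blocks. *)
Lemma ratio_ge_of_increment_le (h v T r : R) : 0 < h -> 0 < v ->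
  (forall t, T <= t -> f (t + h) - f t <= v * h) -> r < v^-1 ->
  exists N, forall n k, (N <= n)%N -> (N <= k)%N -> r <= q n k.
Proof.
move=> h0 v0 Hf rv; have d0 := d_gt0; have C0 := stair_step_gt0.
have [r0|r0] := leP r 0.
  exists 1%N => -[//|n] k _ _; rewrite qE (le_trans r0) //.
  by have := stair_subS n k => ?; rewrite divr_ge0 //; lra.
have vr : v * r < 1 by rewrite mulrC -ltr_pdivlMr // div1r.
have [N0 N0T] := stair_unbounded T.
set N1 := Num.truncn (v * r * (4 * C + h) / ((1 - v * r) * d)).
exists (maxn N0.+2 N1.+1) => n k; rewrite !geq_max => /andP[+ _] /andP[_ N1k].
case: n => // -[//|n]; rewrite !ltnS => N0n.
have N1k' : v * r * (4 * C + h) <= (1 - v * r) * (k%:R * d).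
  rewrite mulrCA -ler_pdivrMr; last by rewrite mulr_gt0 //; lra.
  apply: ltW; apply: lt_le_trans (truncnS_gt _) _; by rewrite ler_nat.
rewrite qE; have /andP[xp xy] := stair_subS n.+1 k.
have yp : 0 < y (n.+1 + k.+1)%N - y n.+1 by lra.
rewrite ler_pdivlMr //.
set X := x (n.+1 + k.+1 + 2)%N - x n.
set j := (Num.truncn (X / h)).+1.
have X0 : 0 <= X / h.
  by rewrite divr_ge0 ?(ltW h0) // subr_ge0 stair_mono //; clear; lia.
have jl : X < j%:R * h by rewrite -ltr_pdivrMr // truncnS_gt.
have ju : j%:R * h <= X + h.
  by rewrite /j -natr1 mulrDl mul1r lerD2r -ler_pdivlMr // truncn_le.
have Tn : T <= x n by rewrite (le_trans (ltW N0T)) // stair_mono.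
have inc := iterated_increment_le (ltW h0) Hf j Tn.
have fl : y (n.+1 + k.+1)%N - c0 <= f (x n + j%:R * h).
  by apply: f_ge; rewrite -addn2; move: jl; rewrite /X; lra.
have fu : f (x n) <= y n.+1 - c0 by apply: f_le; have := x_step n; lra.
have ylen : y (n.+1 + k.+1)%N - y n.+1 <= v * (X + h).
  apply: le_trans (_ : v * (j%:R * h) <= _); last by rewrite ler_pM2l.
  lra.
have xstep := x_step n; have := stair_sub (n.+1 + k.+1)%N 2 => x2.
have Xle : X <= x (n.+1 + k.+1)%N - x n.+1 + 4 * C by rewrite /X; lra.
have xk := stair_sub n.+1 k.+1; move: xk; rewrite -natr1 => xk.
set Z := x (n.+1 + k.+1)%N - x n.+1 in Xle xk xp xy *; clearbody Z.
have Zk : k%:R * d <= Z by lra.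
have main : v * r * (X + h) <= Z.
  apply: le_trans (_ : (v * r) * (Z + (4 * C + h)) <= _).
    rewrite ler_pM2l ?mulr_gt0 //; lra.
  have : (1 - v * r) * (k%:R * d) <= (1 - v * r) * Z by rewrite ler_pM2l //; lra.
  lra.
by apply: le_trans main; rewrite [v * r]mulrC -mulrA ler_pM2l.
Qed.

Lemma ratio_le_of_increment_ge (h v T r : R) : 0 < h -> 0 < v ->
  (forall t, T <= t -> v * h <= f (t + h) - f t) -> v^-1 < r ->
  exists N, forall n k, (N <= n)%N -> (N <= k)%N -> q n k <= r.
Proof.
move=> h0 v0 Hf rv; have d0 := d_gt0; have C0 := stair_step_gt0.
have r0 : 0 < r by rewrite (lt_trans _ rv) // invr_gt0.
have vr : 1 < v * r by rewrite mulrC -ltr_pdivrMr // div1r.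
have [N0 N0T] := stair_unbounded T.
set N1 := Num.truncn (v * r * (3 * C + h) / ((v * r - 1) * d)).
exists (maxn N0.+1 N1.+2) => n k; rewrite !geq_max => /andP[+ _] /andP[_ N1k].
case: n => // n; rewrite ltnS => N0n.
have N1k' : v * r * (3 * C + h) <= (v * r - 1) * (k%:R * d).
  rewrite mulrCA -ler_pdivrMr; last by rewrite mulr_gt0 //; lra.
  apply: ltW; apply: lt_le_trans (truncnS_gt _) _; by rewrite ler_nat ltnW.
rewrite qE; have /andP[xp xy] := stair_subS n k.
have yp : 0 < y (n + k.+1)%N - y n by lra.
rewrite ler_pdivrMr //.
set X := x (n + k)%N - x n.+2.
have X0 : 0 <= X by rewrite subr_ge0 stair_mono //; move: N1k; clear; lia.
set j := Num.truncn (X / h).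
have jl : X - h < j%:R * h.
  have : X < j.+1%:R * h by rewrite -ltr_pdivrMr // truncnS_gt.
  by rewrite -natr1 mulrDl mul1r; lra.
have ju : j%:R * h <= X.
  by rewrite -ler_pdivlMr // truncn_le divr_ge0 // ltW.
have Tn : T <= x n.+2 by rewrite (le_trans (ltW N0T)) // stair_mono // ltnW // ltnW.
have inc := iterated_increment_ge (ltW h0) Hf j Tn.
have fl : y n - c0 <= f (x n.+2) by exact: f_ge.
have xstep := x_step (n + k)%N.
have fu : f (x n.+2 + j%:R * h) <= y (n + k.+1)%N - c0.
  by apply: f_le; rewrite addnS; move: ju; rewrite /X; lra.
have ylen : v * (X - h) <= y (n + k.+1)%N - y n.
  apply: le_trans (_ : v * (j%:R * h) <= _); last by lra.
  by rewrite ler_pM2l // ltW.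
have := stair_sub n 2; rewrite addn2 => x2.
have Xge : x (n + k.+1)%N - x n - 3 * C <= X by rewrite /X addnS; lra.
have xk := stair_sub n k.+1; move: xk; rewrite -natr1 => xk.
set Z := x (n + k.+1)%N - x n in Xge xk xp xy *; clearbody Z.
have Zk : k%:R * d <= Z by lra.
apply: le_trans (_ : r * (v * (X - h)) <= _); last by rewrite ler_pM2l.
apply: le_trans (_ : (v * r) * (Z - (3 * C + h)) <= _); last first.
  rewrite mulrA [r * v]mulrC ler_pM2l ?mulr_gt0 //; lra.
have : (v * r - 1) * (k%:R * d) <= (v * r - 1) * Z by rewrite ler_pM2l //; lra.
lra.
Qed.

End StaircaseIncrements.

Section DoubleLimitTheory.
Context {R : realType}.
Implicit Types (c : nat -> nat -> R) (r : R).

Lemma dlim_infE c : dlim_inf c = ereal_sup (range (fun N : nat => ereal_inf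
  [set (c nk.1 nk.2)%:E | nk in [set nk | (N <= nk.1)%N /\ (N <= nk.2)%N]])).
Proof.
apply/cvg_lim => //; apply: ereal_nondecreasing_cvgn => M N MN.
apply: ereal_inf_le_tmp => _ [nk [Nn Nk] <-]; exists nk => //.
by split; exact: leq_trans MN _.
Qed.

Lemma dlim_supE c : dlim_sup c = ereal_inf (range (fun N : nat => ereal_sup
  [set (c nk.1 nk.2)%:E | nk in [set nk | (N <= nk.1)%N /\ (N <= nk.2)%N]])).
Proof.
apply/cvg_lim => //; apply: ereal_nonincreasing_cvgn => M N MN.
apply: ereal_sup_le => _ [nk [Nn Nk] <-]; exists nk => //.
by split; exact: leq_trans MN _.
Qed.

Lemma dlim_inf_ge c r N :
  (forall n k, (N <= n)%N -> (N <= k)%N -> r <= c n k) -> (r%:E <= dlim_inf c)%E.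
Proof.
move=> H; rewrite dlim_infE; apply: le_ereal_sup_tmp.
eexists; first by exists N.
apply: le_ereal_inf_tmp => _ [nk [Nn Nk] <-]; rewrite lee_fin; exact: H Nn Nk.
Qed.

Lemma dlim_sup_le c r N :
  (forall n k, (N <= n)%N -> (N <= k)%N -> c n k <= r) -> (dlim_sup c <= r%:E)%E.
Proof.
move=> H; rewrite dlim_supE; apply: (le_trans (ereal_inf_lbound _)).
  by exists N.
apply: ge_ereal_sup => _ [nk [Nn Nk] <-]; rewrite lee_fin; exact: H Nn Nk.
Qed.

Lemma dlim_inf_gt c r : (r%:E < dlim_inf c)%E ->
  exists N, forall n k, (N <= n)%N -> (N <= k)%N -> r <= c n k.
Proof.
rewrite dlim_infE => /ereal_sup_gt[_ [N _ <-] rN]; exists N => n k Nn Nk.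
rewrite -lee_fin (le_trans (ltW rN)) //; apply: ereal_inf_lbound.
by exists (n, k).
Qed.

Lemma dlim_sup_lt c r : (dlim_sup c < r%:E)%E ->
  exists N, forall n k, (N <= n)%N -> (N <= k)%N -> c n k <= r.
Proof.
rewrite dlim_supE => /ereal_inf_lt[_ [N _ <-] rN]; exists N => n k Nn Nk.
rewrite -lee_fin (le_trans _ (ltW rN)) //; apply: ereal_sup_ubound.
by exists (n, k).
Qed.

End DoubleLimitTheory.

Section EventualBounds.
Context {R : realType}.
Implicit Types (g : R -> \bar R) (v T : R) (l : \bar R).

Lemma limf_esup_pinfty_le g l T :
  (forall t, T <= t -> (g t <= l)%E) -> (limf_esup g (pinfty_nbhs R) <= l)%E.
Proof.
move=> H; rewrite limf_esupE; apply: (le_trans (ereal_inf_lbound _)).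
  exists [set t | T <= t] => //; exists T; split; first exact: num_real.
  by move=> t /ltW.
by apply: ge_ereal_sup => _ [t Tt <-]; exact: H.
Qed.

Lemma limf_esup_pinfty_lt g l : (limf_esup g (pinfty_nbhs R) < l)%E ->
  exists T, forall t, T <= t -> (g t < l)%E.
Proof.
rewrite limf_esupE => /ereal_inf_lt[_ [V [M [_ MV]] <-] Vl].
exists (M + 1) => t Mt; rewrite (le_lt_trans _ Vl) //.
by apply: ereal_sup_ubound; exists t => //; apply: MV; rewrite (lt_le_trans _ Mt) // ltrDl.
Qed.

Lemma limf_einf_pinfty_ge g l T :
  (forall t, T <= t -> (l <= g t)%E) -> (l <= limf_einf g (pinfty_nbhs R))%E.
Proof.
move=> H; rewrite -leeN2 -limf_esupN; apply: (@limf_esup_pinfty_le _ _ T).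
by move=> t /H; rewrite leeN2.
Qed.

Lemma limf_einf_pinfty_gt g l : (l < limf_einf g (pinfty_nbhs R))%E ->
  exists T, forall t, T <= t -> (l < g t)%E.
Proof.
rewrite -lteN2 -limf_esupN => /limf_esup_pinfty_lt[T H].
by exists T => t /H; rewrite lteN2.
Qed.

Lemma cvge_between (F : set_system R) g l : Filter F ->
  (forall v, (v%:E < l)%E -> \forall h \near F, (v%:E <= g h)%E) ->
  (forall v, (l < v%:E)%E -> \forall h \near F, (g h <= v%:E)%E) ->
  g @ F --> l.
Proof.
move=> FF lo up; case: l lo up => [r| |] lo up.
- apply/fine_cvgP; split.
    have A := lo (r - 1); have B := up (r + 1).
    rewrite !lte_fin in A B; near=> h.
    have : ((r - 1)%:E <= g h <= (r + 1)%:E)%E.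
      by apply/andP; split; near: h; [apply: A | apply: B]; lra.
    by move=> /andP[]; case: (g h).
  apply/cvgrPdist_le => e e0; near=> h.
  have : ((r - e)%:E <= g h <= (r + e)%:E)%E.
    apply/andP; split; near: h; [apply: lo | apply: up]; rewrite lte_fin; lra.
  move=> /andP[] /=; case: (g h) => [s| |] //=.
  by rewrite !lee_fin ler_distl; lra.
- by apply/cvgeyPge => A; apply: lo; rewrite ltry.
- by apply/cvgeNyPle => A; apply: up; rewrite ltNyr.
Unshelve. all: by end_near. Qed.

Lemma lt_dense_EFin (u l : \bar R) : (0 <= u)%E -> (u < l)%E ->
  exists2 v : R, 0 < v & (u < v%:E < l)%E.
Proof.
move=> u0 ul; case: u u0 ul => [u| |] // + ul; last by rewrite ltNge leey in ul.
rewrite lee_fin => u0; case: l ul => [l| |] //; rewrite ?lte_fin => ul.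
  by exists ((u + l) / 2); rewrite ?lte_fin; lra.
by exists (u + 1); rewrite ?lte_fin ?ltry ?andbT; lra.
Qed.

End EventualBounds.

Section IncrementLimits.
Context {R : realType}.
Variables (f : R -> R) (c : nat -> nat -> R).
Hypothesis f_mono : {homo f : s t / s <= t}.

Local Notation inc h := (fun t => ((f (t + h) - f t) / h)%:E).

Let inc_ge0 (h t : R) : 0 < h -> 0 <= (f (t + h) - f t) / h.
Proof. by move=> h0; rewrite divr_ge0 ?(ltW h0) // subr_ge0 f_mono // lerDl ltW. Qed.

Lemma cvg_limsup_increment :
  (forall r v N, 0 < r -> (forall n k, (N <= n)%N -> (N <= k)%N -> r <= c n k) ->
    r^-1 < v -> exists H, forall h, H <= h -> exists T, forall t, T <= t ->
    f (t + h) - f t <= v * h) ->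
  (forall h v T r, 0 < h -> 0 < v ->
    (forall t, T <= t -> f (t + h) - f t <= v * h) -> r < v^-1 ->
    exists N, forall n k, (N <= n)%N -> (N <= k)%N -> r <= c n k) ->
  (0 <= dlim_inf c)%E ->
  limf_esup (inc h) (pinfty_nbhs R) @[h --> +oo%R] --> (dlim_inf c)^-1%E.
Proof.
move=> upper lower c0; set s := dlim_inf c in c0 *.
have s0 : (0 <= s^-1)%E by rewrite inve_ge0.
apply: cvge_between => v.
- move=> vs; near=> h.
  have h0 : 0 < h by near: h; exact: nbhs_pinfty_gt.
  rewrite leNgt; apply/negP => lv.
  have v0 : 0 < v.
    rewrite ltNge; apply/negP => v0.
    have [T /(_ T (lexx T))] := limf_esup_pinfty_lt lv.
    by rewrite lte_fin ltNge (le_trans v0) ?inc_ge0.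
  have [T HT] := limf_esup_pinfty_lt lv.
  have : (v^-1%:E <= s)%E.
    apply/lee_subgt0Pr => e e0.
    have [||N] := lower h v T (v^-1 - e) h0 v0.
    - by move=> t /HT; rewrite lte_fin ltr_pdivrMr // => /ltW.
    - lra.
    - exact: dlim_inf_ge.
  move=> vs'.
  move: vs; rewrite inve_pgt ?inE ?lee_fin ?(ltW v0) //.
  by rewrite inver gt_eqF // ltNge vs'.
- move=> sv.
  have [v' v'0 /andP[sv' v'v]] := lt_dense_EFin s0 sv.
  have v's : (v'^-1%:E < s)%E.
    by move: sv'; rewrite inve_plt ?inE ?lee_fin ?(ltW v'0) // inver gt_eqF.
  have [N HN] := dlim_inf_gt v's.
  have v'V0 : 0 < v'^-1 by rewrite invr_gt0.
  have [|H HH] := upper v'^-1 v N v'V0 HN; first by rewrite invrK -lte_fin.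
  near=> h.
  have h0 : 0 < h by near: h; exact: nbhs_pinfty_gt.
  have [|T HT] := HH h; first by near: h; apply: nbhs_pinfty_ge; exact: num_real.
  apply: (@limf_esup_pinfty_le _ _ _ T) => t /HT.
  by rewrite lee_fin ler_pdivrMr.
Unshelve. all: by end_near. Qed.

Lemma cvg_liminf_increment :
  (forall r v N, 0 < r -> (forall n k, (N <= n)%N -> (N <= k)%N -> c n k <= r) ->
    v < r^-1 -> exists H, forall h, H <= h -> exists T, forall t, T <= t ->
    v * h <= f (t + h) - f t) ->
  (forall h v T r, 0 < h -> 0 < v ->
    (forall t, T <= t -> v * h <= f (t + h) - f t) -> v^-1 < r ->
    exists N, forall n k, (N <= n)%N -> (N <= k)%N -> c n k <= r) ->
  (0 <= dlim_sup c)%E ->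
  limf_einf (inc h) (pinfty_nbhs R) @[h --> +oo%R] --> (dlim_sup c)^-1%E.
Proof.
move=> lower upper c0; set s := dlim_sup c in c0 *.
have s0 : (0 <= s^-1)%E by rewrite inve_ge0.
apply: cvge_between => v.
- move=> vs; have [v0|v0] := leP v 0.
    near=> h; have h0 : 0 < h by near: h; exact: nbhs_pinfty_gt.
    apply: (@limf_einf_pinfty_ge _ _ _ 0) => t _.
    by rewrite lee_fin (le_trans v0) // inc_ge0.
  have sv : (s < (v^-1)%:E)%E.
    by move: vs; rewrite inve_pgt ?inE ?lee_fin ?(ltW v0) // inver gt_eqF.
  have [r r0 /andP[sr rv]] := lt_dense_EFin c0 sv.
  have [N HN] := dlim_sup_lt sr.
  have [|H HH] := lower r v N r0 HN.
    by rewrite -[v]invrK ltf_pV2 ?posrE ?invr_gt0.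
  near=> h.
  have h0 : 0 < h by near: h; exact: nbhs_pinfty_gt.
  have [|T HT] := HH h; first by near: h; apply: nbhs_pinfty_ge; exact: num_real.
  apply: (@limf_einf_pinfty_ge _ _ _ T) => t /HT.
  by rewrite lee_fin ler_pdivlMr.
- move=> sv; near=> h.
  have h0 : 0 < h by near: h; exact: nbhs_pinfty_gt.
  rewrite leNgt; apply/negP => lv.
  have v0 : 0 < v by rewrite -lte_fin (le_lt_trans s0).
  have [T HT] := limf_einf_pinfty_gt lv.
  have : (s <= v^-1%:E)%E.
    apply/lee_addgt0Pr => e e0.
    have [||N] := upper h v T (v^-1 + e) h0 v0.
    - by move=> t /HT; rewrite lte_fin ltr_pdivlMr // => /ltW.
    - lra.
    - exact: dlim_sup_le.
  move=> vs'; move: sv; rewrite inve_plt ?inE ?lee_fin ?(ltW v0) //.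
  by rewrite inver gt_eqF // ltNge vs'.
Unshelve. all: by end_near. Qed.

End IncrementLimits.

(** * The spectral dimensions *)

Lemma dlim_sup_ge (R : realType) (c : nat -> nat -> R) r :
  (forall N, exists n k, [/\ (N <= n)%N, (N <= k)%N & r <= c n k]) ->
  (r%:E <= dlim_sup c)%E.
Proof.
move=> H; rewrite dlim_supE; apply: le_ereal_inf_tmp => _ [N _ <-].
have [n [k [Nn Nk rc]]] := H N; apply: le_ereal_sup_tmp.
by exists (c n k)%:E; [exists (n, k) | rewrite lee_fin].
Qed.

Section FractalSpectrum.
Context {R : realType}.
Variables (a b : R) (p : nat -> nat) (lambda : nat -> R) (w : nat -> nat -> R -> R).
Hypothesis hF : symmetric_system a b p lambda w.
Hypothesis hU : uniformly_generated p lambda.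

Local Notation J := (bd_index a b p w).
Local Notation len := (fun j : J => interval_length (summand_interval j.1)).
Local Notation mu := (eigenvalue_sequence (op_inv (diag_op (fun j : J => (len j)^-1)))).
Local Notation f := (st_f (fractal_triple a b p w)).
Local Notation x := (fun n => ln ((cell_count p n)%:R : R)).
Local Notation y := (fun n => - ln (cell_scale lambda n)).
Local Notation c0 := (ln (b - a)).

Let infJ := boundary_infinite hF.
Let len_gt0 (j : J) : 0 < len j := summand_length_gt0 hF j.1.
Let fin_ge := boundary_finite hF.

Let ab : 0 < b - a. Proof. by rewrite subr_gt0 (sym_ab hF). Qed.

Lemma st_f_eigenvalue t : f t = - ln (mu (Num.truncn (expR t))).
Proof.
rewrite /st_f /st_mu /= (@op_abs_diag _ _ _ (fun j : J => (len j)^-1)) //.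
- by move=> j; rewrite invr_gt0.
- by rewrite fractal_diracE flip_op_adjoint.
- by rewrite fractal_diracE flip_op_square.
Qed.

Let mu_gt0 k : 0 < mu k. Proof. exact: eigenvalue_gt0. Qed.

Lemma st_f_mono : {homo f : s t / s <= t}.
Proof.
move=> s t st; rewrite !st_f_eigenvalue lerN2 ler_ln ?posrE //.
by apply: eigenvalue_anti => //; apply: le_truncn; rewrite ler_expR.
Qed.

Let ln_length n : ln (cell_scale lambda n * (b - a)) = ln (cell_scale lambda n) + c0.
Proof. by rewrite lnM ?posrE // (cell_scale_gt0 hF). Qed.

Let length_gt0 n : 0 < cell_scale lambda n * (b - a).
Proof. by rewrite mulr_gt0 // (cell_scale_gt0 hF). Qed.

Let count_gt0 n : 0 < (cell_count p n)%:R :> R.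
Proof. by rewrite ltr0n (cell_count_gt0 hF). Qed.

Lemma st_f_le n t : t < x n -> f t <= y n - c0.
Proof.
move=> tx; rewrite st_f_eigenvalue -opprD lerN2 -ln_length ler_ln ?posrE //.
have [l [ul sl ll]] := boundary_cells hF n.
apply: (eigenvalue_ge infJ len_gt0 fin_ge ul) => [j /ll ->//|].
by rewrite sl truncn_lt_nat ?expR_ge0 // -[ltRHS]lnK ?posrE // ltr_expR.
Qed.

Lemma st_f_ge n t : x n.+2 <= t -> y n - c0 <= f t.
Proof.
move=> xt; rewrite st_f_eigenvalue -opprD lerN2 -ln_length ler_ln ?posrE //.
apply: (eigenvalue_le infJ len_gt0 fin_ge (M := cell_count p n.+2)).
  by move=> l; exact: boundary_count hF _ _.
by rewrite truncn_ge_nat ?expR_ge0 // -[leLHS]lnK ?posrE // ler_expR.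
Qed.

Lemma ln_countS n : x n.+1 - x n = ln (p n.+1)%:R.
Proof.
rewrite /= cell_countS natrM lnM ?posrE // ?ltr0n; first by rewrite addrAC subrr add0r.
by rewrite (leq_trans _ (sym_p hF _)).
Qed.

Lemma ln_scaleS n : y n.+1 - y n = ln (1 / lambda n.+1).
Proof.
have l0 := sym_lambda hF (ltn0Sn n).
rewrite /= cell_scaleS lnM ?posrE ?(cell_scale_gt0 hF) // div1r lnV ?posrE //; ring.
Qed.

Lemma ln_count_step : exists C, forall n, ln 2 <= x n.+1 - x n <= C.
Proof.
have [sup_lt _] := hU.
have [M pM] : exists M : R, forall n, (1 <= n)%N -> (p n)%:R <= M.
  have sup_ge n : (1 <= n)%N -> (((p n)%:R : R)%:E <=
      ereal_sup [set ((p n)%:R : R)%:E | n in [set n | (1 <= n)%N]])%E.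
    by move=> n1; apply: ereal_sup_ubound; exists n.
  move: sup_lt sup_ge; case: (ereal_sup _) => [M| |] //= _ H.
    by exists M => n /H; rewrite lee_fin.
  by have := H 1%N isT.
exists (ln M) => n; rewrite ln_countS.
have p2 : (2 <= (p n.+1)%:R :> R) by rewrite ler_nat (sym_p hF).
have p0 : 0 < (p n.+1)%:R :> R by apply: lt_le_trans p2.
by rewrite !ler_ln ?posrE ?p2 ?pM // (lt_le_trans p0) // pM.
Qed.

Lemma ln_count_scale_step n : x n.+1 - x n <= y n.+1 - y n.
Proof.
rewrite ln_countS ln_scaleS; have l0 := sym_lambda hF (ltn0Sn n).
have p0 : 0 < (p n.+1)%:R :> R by rewrite ltr0n (leq_trans _ (sym_p hF _)).
by rewrite ler_ln ?posrE ?divr_gt0 // ler_pdivlMr // ltW // (sym_plambda hF).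
Qed.

Lemma log_ratioE m k : log_ratio p lambda m.+1 k =
  (x (m + k.+1)%N - x m) / (y (m + k.+1)%N - y m).
Proof.
have tele (u z : nat -> R) : (forall n, z n.+1 - z n = u n.+1) ->
    \sum_(m.+1 <= j < (m.+1 + k).+1) u j = z (m + k.+1)%N - z m.
  move=> zu; rewrite addSnnS; elim: (k.+1) => [|i IH].
    by rewrite addn0 big_geq // subrr.
  rewrite addnS big_nat_recr /= ?IH -?zu ?ltnS ?leq_addr //; ring.
rewrite /log_ratio (tele _ x); last exact: ln_countS.
by rewrite (tele _ y) //; exact: ln_scaleS.
Qed.

End FractalSpectrum.

Theorem theorem4p20 (R : realType) (a b : R) (p : nat -> nat)
    (lambda : nat -> R) (w : nat -> nat -> R -> R)
    (hF : symmetric_system a b p lambda w)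
    (hU : uniformly_generated p lambda) :
  lower_delta (fractal_triple a b p w) = dlim_inf (log_ratio p lambda) /\
  upper_delta (fractal_triple a b p w) = dlim_sup (log_ratio p lambda).
Proof.
have [C x_step] := ln_count_step hF hU.
have d_gt0 : 0 < ln (2 : R) by rewrite ln_gt0 // ltr1n.
have xy_step := ln_count_scale_step hF.
have f_mono := st_f_mono hF.
have f_le := st_f_le hF.
have f_ge := st_f_ge hF.
have qE := log_ratioE hF.
have q_ge0 n k : (1 <= n)%N -> 0 <= log_ratio p lambda n k.
  case: n => // n _; rewrite qE.
  have /andP[xp xy] := stair_subS d_gt0 x_step xy_step n k.
  by rewrite divr_ge0 ?(ltW xp) // (le_trans (ltW xp)).
have inf_ge0 : (0 <= dlim_inf (log_ratio p lambda))%E.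
  by apply: (@dlim_inf_ge _ _ 0 1) => n k n1 _; exact: q_ge0.
have sup_ge0 : (0 <= dlim_sup (log_ratio p lambda))%E.
  apply: (@dlim_sup_ge _ _ 0) => N; exists N.+1, N; split=> //.
  exact: q_ge0.
split.
- rewrite /lower_delta; set g := (X in lim X).
  suff -> : lim g = (dlim_inf (log_ratio p lambda))^-1%E by rewrite inveK.
  apply/cvg_lim => //; apply: cvg_limsup_increment f_mono _ _ inf_ge0.
  + by move=> r v N; exact: (increment_le_of_ratio_ge d_gt0 x_step xy_step f_le f_ge qE).
  + by move=> h v T r; exact: (ratio_ge_of_increment_le d_gt0 x_step xy_step f_le f_ge qE).
- rewrite /upper_delta; set g := (X in lim X).
  suff -> : lim g = (dlim_sup (log_ratio p lambda))^-1%E by rewrite inveK.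
  apply/cvg_lim => //; apply: cvg_liminf_increment f_mono _ _ sup_ge0.
  + by move=> r v N; exact: (increment_ge_of_ratio_le d_gt0 x_step xy_step f_le f_ge qE).
  + by move=> h v T r; exact: (ratio_le_of_increment_ge d_gt0 x_step xy_step f_le f_ge qE).
Qed.
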